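(* DSNGD (dual stochastic natural gradient descent) in the canonical parametrization, with $\mathcal{Y}=\{1,\dots,s\}$ and $\mathcal{X}=\{1,\dots,m\}$ discrete, converges almost surely to the optimum. That is, let $\overline{P}$ be the unknown probability distribution on $\mathcal{Y}\times\mathcal{X}$ and let $\overline{\eta}\in\mathbb{R}^k$ be the solution of the problem of minimizing $$\mathbb{L}(\eta)=\mathbb{E}_{(x,y)\sim\overline{P}}\left[-\log P_\eta(y\mid x)\right]$$ over $\eta\in\mathbb{R}^k$, $k=(s-1)+s(m-1)$. Let $$\eta_{t+1}=\eta_t-\gamma_t\,\nabla h(x_t,\zeta_t^* )\cdot\left(q_{\mathcal{Y}}(x_t,P_{\eta_t})-e_s(y_t)\right),$$ where $(x_t,y_t)$ are observations sampled from $\overline{P}$, the learning rates $\gamma_t>0$ satisfy $\sum_t\gamma_t=\infty$ and $\sum_t\gamma_t^2<\infty$, and $\{\zeta_t^*\}_{t\in\mathbb{N}}$ is a sequence in the expectation (dual) parametrization such that the corresponding sequence $\{\zeta_t\}_{t\in\mathbb{N}}$ of natural parameters converges. Then $\eta_t$ converges almost surely to $\overline{\eta}$.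
   Context: The canonical parametrization uses the canonical statistics $S:\{1,\dots,s\}\to\mathbb{R}^{s-1}$, $S(i)_j=\delta_{i=j}$ for $i<s$, $S(s)=0$, and $T:\{1,\dots,m\}\to\mathbb{R}^{m-1}$, $T(i)_j=\delta_{i=j}$ for $i<m$, $T(m)=0$. For natural parameters $\eta=(\alpha,\beta)\in\mathbb{R}^k$, with $\alpha\in\mathbb{R}^{s-1}$ and $\beta\in\mathbb{R}^{s\times(m-1)}$ having rows $\beta_1,\dots,\beta_s$, $$P_\eta(x,y)=\frac{\exp(S(y)^\intercal\alpha+T(x)^\intercal\beta_y)}{\sum_{x',y'}\exp(S(y')^\intercal\alpha+T(x')^\intercal\beta_{y'})},\qquad P_\eta(y\mid x)=\frac{\exp(S(y)^\intercal\alpha+T(x)^\intercal\beta_y)}{\sum_{y'}\exp(S(y')^\intercal\alpha+T(x)^\intercal\beta_{y'})}.$$ The expectation (dual) parameters corresponding to natural parameters $\zeta$ are $\zeta^*=(\alpha^*,\beta_1^*,\dots,\beta_s^* )$ with $\alpha^*=(P_\zeta(\mathcal{Y}=1),\dots,P_\zeta(\mathcal{Y}=s-1))^\intercal$ and $\beta_y^*=(P_\zeta(\mathcal{X}=1,\mathcal{Y}=y),\dots,P_\zeta(\mathcal{X}=m-1,\mathcal{Y}=y))^\intercal$; $P_{\zeta^*}$ denotes the same distribution as $P_\zeta$. Further, $q_{\mathcal{Y}}(x,P)=(P(\mathcal{Y}=1\mid x),\dots,P(\mathcal{Y}=s\mid x))^\intercal$; $e_s(y)$ is the $y$-th canonical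 vector of $\mathbb{R}^s$; $h(x,\zeta^* )=(\log P_{\zeta^*}(\mathcal{Y}=1,x),\dots,\log P_{\zeta^*}(\mathcal{Y}=s,x))$; and $\nabla h(x,\zeta^* )$ is the $k\times s$ matrix whose $i$-th column is the gradient of the $i$-th entry of $h$ with respect to the dual parameters. The algorithm starts from an initial estimate $\eta_0$ and an initial $\zeta_0^*$; in each iteration the current $\zeta^*$ is used to update $\eta$, and $\zeta^*$ is updated afterwards.
   Formalization: For m ≥ 2 the minimizer of L is never unique (adding one vector to all β_y changes no P_η(y|x)), so ''the solution'' is ill-defined; proved instead: a.s. the distance of η_t to the set of minimizers tends to 0, and η_t converges to η̄ when η̄ is the only minimizer. *)

(* Defs.v *)
From HB Require Import structures.
From mathcomp Require Import all_boot all_order all_algebra.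
From mathcomp Require Import all_classical all_reals all_analysis.
Import Order.TTheory GRing.Theory Num.Theory.
Import numFieldNormedType.Exports.

Set Implicit Arguments.
Unset Strict Implicit.
Unset Printing Implicit Defensive.

Local Open Scope classical_set_scope.
Local Open Scope ring_scope.

(* The labels {1,..,s} are 'I_s and the inputs {1,..,m} are 'I_m, shifted to
   start from 0: the reference class s (resp. m), whose statistic is zero, is the
   ordinal with value s.-1 (resp. m.-1).
   Parameter vectors are rows (alpha, beta_1, .., beta_s) in R^k with
   k = (s - 1) + s (m - 1). *)
Notation nparam s m := (s.-1 + s * m.-1)%N.

(* Inclusion of the non-reference classes. *)
Definition nonref n (i : 'I_n.-1) : 'I_n := widen_ord (leq_pred n) i.

Section model.
Context {R : realType} {s m : nat}.
Implicit Types (eta zeta theta : 'rV[R]_(nparam s m)) (x : 'I_m) (y : 'I_s).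

Definition alpha eta : 'rV[R]_(s.-1) := lsubmx eta.
Definition beta eta : 'M[R]_(s, m.-1) := vec_mx (rsubmx eta).

(* S is stat at n = s and T is stat at n = m; the row is zero at the last
   class since j < n.-1. *)
Definition stat n (i : 'I_n) : 'rV[R]_(n.-1) :=
  \row_(j < n.-1) ((i : nat) == (j : nat))%:R.

Definition score eta x y : R :=
  (stat y *m (alpha eta)^T) 0 0 + (stat x *m (row y (beta eta))^T) 0 0.

Definition joint eta x y : R :=
  expR (score eta x y) / \sum_(x' < m) \sum_(y' < s) expR (score eta x' y').

Definition conditional eta x y : R :=
  expR (score eta x y) / \sum_(y' < s) expR (score eta x y').

(* The expectation parameters zeta^* of the natural parameters zeta. *)
Definition dual zeta : 'rV[R]_(nparam s m) :=
  row_mx (\row_(j < s.-1) \sum_(x < m) joint zeta x (nonref j))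
         (mxvec (\matrix_(y < s, i < m.-1) joint zeta (nonref i) y)).

(* P_theta(x, y) for expectation parameters theta: the mass at the reference
   label or input is what is missing from 1, respectively from P_theta(y).
   Lemma dual_joint_dual below: this is P_zeta when theta = zeta^*. *)
Definition dual_label theta y : R :=
  if insub (y : nat) is Some j then alpha theta 0 j
  else 1 - \sum_(j < s.-1) alpha theta 0 j.

Definition dual_joint theta x y : R :=
  if insub (x : nat) is Some i then beta theta y i
  else dual_label theta y - \sum_(i < m.-1) beta theta y i.

Definition h x theta : 'rV[R]_s := \row_(y < s) ln (dual_joint theta x y).

(* k x s; jacobians act on row vectors from the right, so that column y is the
   gradient of the entry y of h x. *)
Definition grad_h x theta : 'M[R]_(nparam s m, s) := jacobian (h x) theta.

Definition qY x eta : 'cV[R]_s := \col_(y < s) conditional eta x y.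

Definition DSNGD_step (gamma : R) theta x y eta : 'rV[R]_(nparam s m) :=
  eta - gamma *: (grad_h x theta *m (qY x eta - delta_mx y 0))^T.

Definition is_pmf (Pbar : 'I_m -> 'I_s -> R) : Prop :=
  (forall x y, 0 <= Pbar x y) /\ \sum_(x < m) \sum_(y < s) Pbar x y = 1.

Definition loss (Pbar : 'I_m -> 'I_s -> R) eta : R :=
  \sum_(x < m) \sum_(y < s) Pbar x y * - ln (conditional eta x y).

Definition is_solution (Pbar : 'I_m -> 'I_s -> R) eta : Prop :=
  forall eta', loss Pbar eta <= loss Pbar eta'.

End model.

Section sampling.
Context d (T : measurableType d) (R : realType).

Definition is_filtration (F : nat -> set_system T) : Prop :=
  [/\ forall t, sigma_algebra [set: T] (F t),
      forall t, F t `<=` measurable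
    & forall t u, (t <= u)%N -> F t `<=` F u].

Definition measurable_wrt (G : set_system T) n (f : T -> 'rV[R]_n) : Prop :=
  forall i : 'I_n,
    preimage_set_system [set: T] (fun w => f w 0 i) measurable `<=` G.

(* F t is the information available before the t-th observation is drawn:
   each observation has law Pbar, is independent of the past F t and belongs to
   the past from time t.+1 on.  In particular the observations are i.i.d. *)
Definition is_sampling (P : probability T R) (F : nat -> set_system T)
    m s (Pbar : 'I_m -> 'I_s -> R) (X : nat -> T -> 'I_m) (Y : nat -> T -> 'I_s)
    : Prop :=
  forall t (x : 'I_m) (y : 'I_s),
    F t.+1 [set w | X t w = x /\ Y t w = y] /\
    forall A, F t A ->
      P (A `&` [set w | X t w = x /\ Y t w = y]) = (P A * (Pbar x y)%:E)%E.

End sampling.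

Definition converges_to_set (R : realType) n (u : nat -> 'rV[R]_n)
    (A : set 'rV[R]_n) : Prop :=
  forall e : R, 0 < e ->
    \forall t \near \oo, exists2 a, A a & `|u t - a| < e.

Section coherence.
Context {R : realType}.

Lemma sum_nonref n (f : 'I_n -> R) (i : 'I_n) :
  (i < n.-1)%N = false -> \sum_(j < n.-1) f (nonref j) = \sum_j f j - f i.
Proof.
case: n f i => [f []//|n] f i /= Hi.
rewrite big_ord_recr /= (_ : ord_max = i); last first.
  apply/val_inj => /=; apply/eqP; rewrite eqn_leq [X in X && _]leqNgt Hi /=.
  by rewrite -ltnS ltn_ord.
by rewrite addrK; apply: eq_bigr => j _; congr f; apply: val_inj.
Qed.

Context {s m : nat}.

Lemma sum_joint (zeta : 'rV[R]_(nparam s m)) : (0 < s)%N -> (0 < m)%N ->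
  \sum_(y < s) \sum_(x < m) joint zeta x y = 1.
Proof.
move=> s0 m0; rewrite exchange_big /=.
under eq_bigr do rewrite -mulr_suml.
rewrite -mulr_suml divff// gt_eqF//.
rewrite (bigD1 (Ordinal m0))//= (bigD1 (Ordinal s0))//=.
rewrite -addrA ltr_pwDl ?expR_gt0// addr_ge0//.
  by apply: sumr_ge0 => *; exact: expR_ge0.
by do 2![apply: sumr_ge0 => ? _]; exact: expR_ge0.
Qed.

Lemma dual_joint_dual (zeta : 'rV[R]_(nparam s m)) (x : 'I_m) (y : 'I_s) :
  dual_joint (dual zeta) x y = joint zeta x y.
Proof.
have s0 : (0 < s)%N by apply: leq_ltn_trans (ltn_ord y).
have m0 : (0 < m)%N by apply: leq_ltn_trans (ltn_ord x).
have bE : beta (dual zeta) = \matrix_(y, i) joint zeta (nonref i) y.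
  by rewrite /beta /dual row_mxKr mxvecK.
have lE : dual_label (dual zeta) y = \sum_x joint zeta x y.
  rewrite /dual_label /alpha /dual row_mxKl; case: insubP => [j _ jy|].
    rewrite mxE; apply: eq_bigr => i _; congr (joint zeta i _).
    exact: val_inj.
  move/negbTE => Hy; under eq_bigr do rewrite mxE.
  rewrite (sum_nonref (fun y => \sum_x joint zeta x y) Hy).
  by rewrite sum_joint// opprB addrCA subrr addr0.
rewrite /dual_joint bE lE; case: insubP => [i _ ix|/negbTE Hx].
  by rewrite mxE; congr (joint zeta _ y); apply: val_inj.
under [X in _ - X]eq_bigr do rewrite mxE.
by rewrite (sum_nonref (fun x => joint zeta x y) Hx) opprB addrCA subrr addr0.
Qed.

End coherence.

(* Main.v *)
Require Import Defs.
From HB Require Import structures.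
From mathcomp Require Import all_boot all_order all_algebra.
From mathcomp Require Import all_classical all_reals all_analysis.
From mathcomp Require Import measurable_realfun ring lra.

Set Implicit Arguments.
Unset Strict Implicit.
Unset Printing Implicit Defensive.

Import Order.TTheory GRing.Theory Num.Theory.
Import numFieldNormedType.Exports.

Local Open Scope classical_set_scope.
Local Open Scope ring_scope.

(** Write r for the marginal of Pbar on the inputs, q_t for the conditional
    model at eta_t, Q_t (x, y) = r x * q_t (y | x), and g_t = Q_t - Pbar; the
    latter is the gradient of the loss with respect to the scores.

    The step.  The mass P_theta(x, y) is an affine function of the expectation
    parameters theta, and theta = zeta^* is the expectation of the sufficient
    statistic.  So the differential of the mass at (x, y), paired with the
    sufficient statistic of (x', y'), is the Kronecker delta of (x, y) and
    (x', y') minus a term that does not depend on (x', y')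
    (dual_joint_suffstat).  The natural gradient step therefore moves, up to a
    constant common to all scores, only the scores of the observed input x, the
    one of y' by - gamma (q(y' | x) - 1[y = y']) / P_zeta(x, y')
    (score_DSNGD_step); no Fisher matrix has to be inverted.

    The Lyapunov function is the loss itself.  A distance to a solution in the
    Fisher metric would not do: that metric moves with zeta_t, its limit is not
    adapted, and the solutions form an affine space.  By a second order bound on
    log-sum-exp, a step changes the loss by at most - gamma times a first order
    gain plus 4 (gamma K)^2, where K bounds 1 / P_zeta (loss_DSNGD_step).  Given
    the past, the mean of the gain is S = sum of g^2 / P_zeta >= sum of g^2
    (gain_centered).  The centred gains, weighted by gamma_t, form martingale
    differences with square summable bounds once 1 / P_zeta is truncated at K,
    so their series converges almost surely
    (martingale_difference_series_cvg).  On a path where zeta_t converges,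
    1 / P_zeta is bounded (joint_inv_bounded) and the truncation at some integer
    K is harmless.  Hence on almost every path the gap D_t of the loss to its
    minimum satisfies D_(t+1) <= D_t - gamma_t S_t + b_t with a convergent
    series b, and D_t tends to 0 as soon as a small S_t forces a small D_t
    (perturbed_descent_cvg0).

    The geometry of the loss.  The model is saturated: every matrix of scores is
    realised up to an additive constant (score_surjective).  So g vanishes at a
    minimiser (solution_residual), the gap D is the relative entropy of Pbar
    with respect to Q (loss_gapE), and no convexity argument is needed: for
    small g, D is at most twice a chi-square divergence, which is controlled by
    the sum of g^2 (loss_gap_small), and in general it dominates the squared
    Hellinger distance.  Thus D_t -> 0 gives q_t -> q_etabar at the inputs
    charged by Pbar, and correcting the scores of eta_t by the small differences
    of the log-probabilities yields a solution close to eta_t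
    (converges_to_solutions). *)

(** * Random variables measurable for a sub-sigma-algebra *)

Section sub_sigma_algebra.
Context {d} {T : measurableType d} {R : realType}.
Implicit Types (G : set_system T) (f g : T -> R).

Definition measurable_for G f :=
  measurable_fun [set: g_sigma_algebraType G] (f : g_sigma_algebraType G -> R).

Definition bounded_rv f := exists C : R, forall w, `|f w| <= C.

Lemma measurable_forS G G' f :
  sigma_algebra [set: T] G -> G `<=` G' -> measurable_for G f -> measurable_for G' f.
Proof.
move=> sG GG' mf _ B mB; have := mf measurableT B mB.
rewrite measurable_g_measurableTypeE// => /GG'; exact: sub_sigma_algebra.
Qed.

Lemma measurable_for_measurable G f : sigma_algebra [set: T] G ->
  G `<=` measurable -> measurable_for G f -> measurable_fun [set: T] f.
Proof.
move=> sG Gm mf _ B mB; have := mf measurableT B mB.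
by rewrite measurable_g_measurableTypeE// => /Gm.
Qed.

End sub_sigma_algebra.

Section bounded.
Context {d} {T : measurableType d} {R : realType} (P : probability T R).
Implicit Types (f g : T -> R).

Lemma bounded_rv_integrable f : measurable_fun [set: T] f -> bounded_rv f ->
  P.-integrable [set: T] (EFin \o f).
Proof.
move=> mf [C fC]; apply: measurable_bounded_integrable => //.
  by rewrite -ge0_fin_numE ?fin_num_measure.
exists C; split; first exact: num_real.
  by move=> M CM w _; exact: le_trans (fC w) (ltW CM).
Qed.

(** Both sides are integrals of the identity for a pushforward along f: of P
    restricted to E on the left, of p P on the right.  The hypothesis says that
    these two measures on the line agree. *)
Lemma ge0_integral_indep (E : set T) (p : R) f :
  measurable E -> 0 <= p -> measurable_fun [set: T] f -> (forall w, 0 <= f w) ->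
  (forall B, measurable B -> P (f @^-1` B `&` E) = (P (f @^-1` B) * p%:E)%E) ->
  (\int[P]_(w in E) (f w)%:E = p%:E * \int[P]_w (f w)%:E)%E.
Proof.
move=> mE p0 mf f0 PE.
pose D : set R := [set r | 0 <= r].
have fD : f @^-1` D = setT by apply/seteqP; split => // w _; exact: f0.
have mD : measurable D.
  rewrite (_ : D = `[0, +oo[%classic)//.
  by apply/seteqP; split => r /=; rewrite in_itv/= andbT.
have mef : measurable_fun [set: T] (EFin \o f) by exact/measurable_EFinP.
transitivity (\int[mrestr P mE]_w (f w)%:E)%E.
  have -> : (\int[mrestr P mE]_w (f w)%:E =
      \int[mrestr P mE]_(w in setT `\` ~` E) (f w)%:E)%E.
    apply: ge0_negligible_integral => //=.
    - exact: measurableC.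
    - by move=> w _; rewrite lee_fin.
    - by rewrite /mrestr setICl measure0.
  rewrite setTD setCK; apply: eq_measure_integral => A mA AE.
  by rewrite /= /mrestr setIidl.
transitivity (\int[pushforward (mrestr P mE) f]_(r in D) r%:E)%E.
  by rewrite ge0_integral_pushforward// ?fD//; move=> r; rewrite inE lee_fin.
transitivity (\int[pushforward (mscale (NngNum p0) P) f]_(r in D) r%:E)%E.
  apply: eq_measure_integral => A mA _.
  by rewrite /= /mrestr /mscale /pushforward PE//= muleC.
rewrite ge0_integral_pushforward// ?fD//; last first.
  by move=> r; rewrite inE lee_fin.
by rewrite ge0_integral_mscale//= => w _; rewrite lee_fin.
Qed.

(** E is an event of probability p independent of G. *)
Lemma Rintegral_indep (G : set_system T) (E : set T) (p : R) f :
  sigma_algebra [set: T] G -> G `<=` measurable -> measurable E -> 0 <= p ->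
  (forall A, G A -> P (A `&` E) = (P A * p%:E)%E) ->
  measurable_for G f -> bounded_rv f ->
  \int[P]_w (f w * \1_E w) = p * \int[P]_w f w.
Proof.
move=> sG Gm mE p0 PE mf [C fC].
have mf' := measurable_for_measurable sG Gm mf.
have PE' (g : T -> R) : measurable_for G g -> (forall w, 0 <= g w) -> bounded_rv g ->
    \int[P]_w (g w * \1_E w) = p * \int[P]_w g w.
  move=> mg g0 bg.
  have mg' := measurable_for_measurable sG Gm mg.
  rewrite -(_ : \int[P]_(w in E) g w = \int[P]_w (g w * \1_E w)); last first.
    rewrite Rintegral_mkcond; apply: eq_Rintegral => w _.
    by rewrite patchE indicE; case: (w \in E); rewrite (mulr1, mulr0).
  rewrite /Rintegral (@ge0_integral_indep E p)//; last first.
    move=> B mB; apply: PE; have := mg measurableT B mB.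
    by rewrite measurable_g_measurableTypeE// setTI.
  by rewrite fineM//; apply: integrable_fin_num => //; exact: bounded_rv_integrable.
(* f + C is nonnegative; the constant C is subtracted at the end. *)
pose g w := f w + C.
have C0 w : 0 <= f w + C by have := fC w; rewrite ler_norml; lra.
have bcst c : bounded_rv (cst c : T -> R) by exists `|c|.
have bg : bounded_rv g.
  by exists (C + C) => w; apply: le_trans (ler_normD _ _) _; rewrite lerD//
    ger0_norm//; apply: le_trans (fC w).
have mg : measurable_for G g by apply: measurable_funD => //; exact: measurable_cst.
have mI : measurable_fun [set: T] (\1_E : T -> R) by exact: measurable_indic.
have bI : bounded_rv (\1_E : T -> R).
  by exists 1 => w; rewrite indicE; case: (w \in E); rewrite (normr0, normr1).
have intf := bounded_rv_integrable mf' (ex_intro _ C fC).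
have intC : P.-integrable [set: T] (EFin \o (cst C : T -> R)).
  by apply: bounded_rv_integrable => //; exact: measurable_cst.
have := PE' g mg C0 bg; rewrite RintegralD// mulrDr.
under eq_Rintegral do rewrite mulrDl.
rewrite RintegralD//; last 2 first.
- apply: bounded_rv_integrable; first exact: measurable_funM.
  exists C => w; rewrite normrM indicE; case: (w \in E).
    by rewrite normr1 mulr1.
  by rewrite normr0 mulr0; apply: le_trans (fC w).
- apply: bounded_rv_integrable; first exact: measurable_funM.
  exists `|C| => w; rewrite normrM indicE; case: (w \in E).
    by rewrite normr1 mulr1.
  by rewrite normr0 mulr0.
have := PE' (cst `|C|) (measurable_cst _) (fun=> normr_ge0 C) (bcst _).
have [C0'|] := leP 0 C; last first.
  by move=> Cn; move: (fC point) => /le_lt_trans/(_ Cn); rewrite normr_lt0.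
by rewrite (ger0_norm C0') => -> /addIr.
Qed.

End bounded.

(** * Almost sure convergence of square summable martingales *)

Section martingale.
Context {d} {T : measurableType d} {R : realType} (P : probability T R).

(** A vanishing conditional expectation given F k, in the form of orthogonality
    to the bounded variables known at time k. *)
Definition martingale_difference (F : nat -> set_system T) (u : nat -> T -> R) :=
  forall k, measurable_for (F k.+1) (u k) /\
    forall f, measurable_for (F k) f -> bounded_rv f ->
      \int[P]_w (f w * u k w) = 0.

(** Partial sums of v, frozen from the first time they reach lam in absolute
    value on.  The bound on their second moment replaces a decomposition along
    the first exit time in the maximal inequality. *)
Fixpoint stopped_sum (lam : R) (v : nat -> R) (n : nat) : R :=
  if n is k.+1 then
    let s := stopped_sum lam v k in s + (if `|s| < lam then v k else 0)
  else 0.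

Lemma stopped_sum_exit lam v n :
  (exists2 k, (k <= n)%N & lam <= `|\sum_(0 <= i < k) v i|) ->
  lam <= `|stopped_sum lam v n|.
Proof.
suff H : `|stopped_sum lam v n| < lam ->
    (forall k, (k <= n)%N -> `|\sum_(0 <= i < k) v i| < lam) /\
    stopped_sum lam v n = \sum_(0 <= i < n) v i.
  by move=> [k kn]; apply: contraTT; rewrite -!ltNge => /H[/(_ k kn)].
elim: n => [|n IH] /=.
  by rewrite big_nil => l0; split => // k; rewrite leqn0 => /eqP ->; rewrite big_nil.
case: ifPn => [sl|]; last by rewrite addr0 => /negbTE ->.
have [IH1 IH2] := IH sl.
rewrite IH2 => sl'; split; last by rewrite big_nat_recr.
move=> k; rewrite leq_eqVlt => /orP[/eqP ->|]; first by rewrite big_nat_recr.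
by rewrite ltnS; exact: IH1.
Qed.

Variables (F : nat -> set_system T).
Hypothesis filF : is_filtration F.

Let sF t : sigma_algebra [set: T] (F t). Proof. by case: filF. Qed.
Let mF t : F t `<=` measurable. Proof. by case: filF. Qed.

Lemma measurable_for_stopped_sum u lam n : martingale_difference F u ->
  measurable_for (F n) (fun w => stopped_sum lam (u ^~ w) n).
Proof.
move=> mu; elim: n => [|n IH] /=; first exact: measurable_cst.
have Fn : F n `<=` F n.+1 by case: filF => _ _; apply.
have IH' := measurable_forS (sF n) Fn IH.
apply: measurable_funD => //; apply: measurable_fun_ifT => //.
- apply: measurable_fun_ltr; last exact: measurable_cst.
  exact: measurableT_comp.
- exact: (mu n).1.
Qed.

(** The cross terms vanish: whether the sum is already frozen at time k is
    decided by F k. *)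
Lemma stopped_sum_second_moment u (c : nat -> R) lam n :
  martingale_difference F u -> (forall k w, `|u k w| <= c k) ->
  bounded_rv (fun w => stopped_sum lam (u ^~ w) n) /\
  \int[P]_w (stopped_sum lam (u ^~ w) n ^+ 2) <= \sum_(0 <= k < n) c k ^+ 2.
Proof.
move=> mu uc; elim: n => [|n [[C IHC] IH]].
  split; first by exists 0 => w /=; rewrite normr0.
  rewrite big_nil /=; under eq_Rintegral do rewrite expr0n/=.
  by rewrite Rintegral_cst// mul0r.
pose S w := stopped_sum lam (u ^~ w) n.
have SC w : `|S w| <= C by exact: IHC.
pose I w : R := if `|S w| < lam then 1 else 0.
have SE w : stopped_sum lam (u ^~ w) n.+1 = S w + I w * u n w.
  by rewrite /= -/(S w) /I; case: ifP => _; rewrite ?mul1r ?mul0r.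
have mS : measurable_for (F n) S by exact: measurable_for_stopped_sum.
have mI : measurable_for (F n) I.
  apply: measurable_fun_ifT; try exact: measurable_cst.
  by apply: measurable_fun_ltr; [exact: measurableT_comp|exact: measurable_cst].
have I1 w : `|I w| <= 1 by rewrite /I; case: ifP; rewrite ?normr1 ?normr0.
have C0 : 0 <= C := le_trans (normr_ge0 _) (IHC point).
have c0 k : 0 <= c k := le_trans (normr_ge0 _) (uc k point).
have Iu w : `|I w * u n w| <= c n.
  by rewrite normrM -[c n]mul1r ler_pM.
have mu' : measurable_fun [set: T] (u n).
  exact: measurable_for_measurable (sF n.+1) (@mF n.+1) (mu n).1.
have mS' := measurable_for_measurable (sF n) (@mF n) mS.
have mI' := measurable_for_measurable (sF n) (@mF n) mI.
have mIu : measurable_fun [set: T] (fun w => I w * u n w) by exact: measurable_funM.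
have bS2 : bounded_rv (fun w => S w ^+ 2).
  by exists (C ^+ 2) => w; rewrite normrX lerXn2r ?nnegrE ?SC.
have bSI : bounded_rv (fun w => 2 * S w * I w).
  exists (2 * C * 1) => w; rewrite !normrM normr_nat.
  by apply: ler_pM; rewrite ?mulr_ge0//; apply: ler_pM; rewrite ?SC.
have bIu2 : bounded_rv (fun w => (I w * u n w) ^+ 2).
  by exists (c n ^+ 2) => w; rewrite normrX lerXn2r ?nnegrE ?Iu.
split.
  exists (C + c n) => w; rewrite SE.
  by apply: le_trans (ler_normD _ _) _; rewrite lerD.
have mSI : measurable_for (F n) (fun w => 2 * S w * I w).
  by apply: measurable_funM => //; apply: measurable_funM => //; exact: measurable_cst.
have intS2 : P.-integrable [set: T] (EFin \o (fun w => S w ^+ 2)).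
  by apply: bounded_rv_integrable => //; exact: measurable_funX.
have intIu2 : P.-integrable [set: T] (EFin \o (fun w => (I w * u n w) ^+ 2)).
  by apply: bounded_rv_integrable => //; exact: measurable_funX.
have intX : P.-integrable [set: T] (EFin \o (fun w => 2 * S w * I w * u n w)).
  apply: bounded_rv_integrable.
    apply: measurable_funM => //; exact: measurable_for_measurable (sF n) (@mF n) mSI.
  have [K hK] := bSI; exists (K * c n) => w; rewrite normrM ler_pM//.
rewrite (@eq_Rintegral _ _ _ P _
  (fun w => S w ^+ 2 + 2 * S w * I w * u n w + (I w * u n w) ^+ 2)); last first.
  by move=> w _; rewrite SE; ring.
rewrite RintegralD//; last exact: (integrableD measurableT intS2 intX).
rewrite RintegralD// (mu n).2// addr0 big_nat_recr//= lerD//.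
apply: (@le_trans _ _ (\int[P]_w (cst (c n ^+ 2) w))).
  apply: le_Rintegral => //.
    apply: bounded_rv_integrable; first exact: measurable_cst.
    by exists `|c n ^+ 2|.
  by move=> w _; rewrite -real_normK ?num_real// lerXn2r ?nnegrE.
have P1 : fine (P [set: T]) = 1 by rewrite probability_setT.
by rewrite Rintegral_cst// P1 mulr1.
Qed.

(** Kolmogorov's maximal inequality.  Once the partial sums have left the
    interval ]-lam, lam[, so have the stopped sums forever; thus B is an
    increasing union of events controlled by Chebyshev's inequality. *)
Lemma maximal_inequality u (c : nat -> R) (lam K : R) :
  martingale_difference F u -> (forall k w, `|u k w| <= c k) -> 0 < lam ->
  (forall n, \sum_(0 <= k < n) c k ^+ 2 <= K) ->
  exists2 B, measurable B /\ (P B <= (K / lam ^+ 2)%:E)%E &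
    forall w n, lam <= `|\sum_(0 <= k < n) u k w| -> B w.
Proof.
move=> mu uc lam0 cK.
pose S n w := stopped_sum lam (u ^~ w) n.
pose B n := [set w | lam <= `|S n w|].
have mS n : measurable_fun [set: T] (S n).
  apply: measurable_for_measurable (sF n) (@mF n) _ => //.
  exact: measurable_for_stopped_sum.
have mB n : measurable (B n).
  have := measurable_fun_ler (measurable_cst lam)
    (measurableT_comp (@normr_measurable R setT) (mS n)).
  move=> /(_ measurableT [set true] I); rewrite setTI.
  by congr measurable; apply/seteqP; split.
have PB n : (P (B n) <= (K / lam ^+ 2)%:E)%E.
  have [[C SC] SK] := stopped_sum_second_moment lam n mu uc.
  have PBf : P (B n) \is a fin_num by exact: fin_num_measure.
  rewrite -(fineK PBf) lee_fin ler_pdivlMr ?exprn_gt0//.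
  apply: le_trans (cK n); apply: le_trans SK.
  have -> : fine (P (B n)) * lam ^+ 2 = \int[P]_w (lam ^+ 2 * \1_(B n) w).
    rewrite RintegralZl//; last first.
      apply: bounded_rv_integrable; first exact: measurable_indic.
      by exists 1 => w; rewrite indicE; case: (w \in _); rewrite (normr0, normr1).
    by rewrite mulrC /Rintegral integral_indic// setIT.
  apply: le_Rintegral => //.
  - apply: bounded_rv_integrable.
      by apply: measurable_funM; [exact: measurable_cst|exact: measurable_indic].
    exists (lam ^+ 2) => w; rewrite indicE normrM ger0_norm ?sqr_ge0//.
    by case: (w \in _); rewrite (normr0, normr1) ?mulr1 ?mulr0// sqr_ge0.
  - apply: bounded_rv_integrable; first exact: measurable_funX (mS n).
    exists (C ^+ 2) => w; rewrite normrX lerXn2r ?nnegrE//.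
    exact: le_trans (SC w).
  - move=> w _; rewrite indicE; case: (boolP (w \in B n)) => [|_].
      rewrite inE /B /= mulr1 => h.
      by rewrite -[leRHS]real_normK ?num_real// lerXn2r ?nnegrE// ltW.
    by rewrite mulr0 sqr_ge0.
exists (\bigcup_n B n).
  split; first exact: bigcupT_measurable.
  have ndB : nondecreasing_seq B.
    apply/nondecreasing_seqP => n; apply/subsetPset => w; rewrite /B/S/= => h.
    by rewrite ltNge h addr0.
  have PBcvg : P \o B @ \oo --> P (\bigcup_n B n).
    by apply: nondecreasing_cvg_mu => //; exact: bigcupT_measurable.
  rewrite -(cvg_lim _ PBcvg)//; apply: lime_le; last exact: nearW.
  by apply/cvg_ex; exists (P (\bigcup_n B n)).
move=> w n h; exists n => //; apply: stopped_sum_exit; by exists n.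
Qed.

End martingale.

Section martingale_convergence.
Context {d} {T : measurableType d} {R : realType} (P : probability T R).
Variables (F : nat -> set_system T).
Hypothesis filF : is_filtration F.

(** By the maximal inequality for the shifted filtrations, the oscillation of
    the partial sums after time m exceeds e with a probability that tends to 0
    as m grows: almost surely the partial sums are Cauchy. *)
Lemma martingale_difference_series_cvg u (c : nat -> R) :
  martingale_difference P F u -> (forall k w, `|u k w| <= c k) ->
  cvgn (series (fun k => c k ^+ 2)) ->
  {ae P, forall w, cvgn (series (u ^~ w))}.
Proof.
move=> mu uc cc.
have tail (e : R) : 0 < e -> exists m, forall n,
    \sum_(0 <= k < n) c (m + k)%N ^+ 2 <= e.
  move=> e0; move/cauchy_cvgP/cauchy_seriesP: cc => /(_ e e0).
  move=> [[A1 A2]/= [[N1 _ h1] [N2 _ h2]] hA].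
  exists (maxn N1 N2) => n; set m := maxn _ _.
  have := hA (m, (m + n)%N); rewrite /= => /(_ _)/ltW.
  have -> : \sum_(m <= k < m + n) c k ^+ 2 = \sum_(0 <= k < n) c (m + k)%N ^+ 2.
    rewrite -{1}[m]add0n big_addn addKn.
    by apply: eq_bigr => i _; rewrite addnC.
  rewrite ger0_norm; last by apply: sumr_ge0 => i _; exact: sqr_ge0.
  apply; split; [apply: h1|apply: h2]; rewrite /= /m ?leq_maxl//.
  by rewrite (leq_trans (leq_maxr N1 N2))// leq_addr.
have ex (e : R) : 0 < e -> P.-negligible
    [set w | forall m, exists n, e <= `|\sum_(0 <= k < n) u (m + k)%N w|].
  move=> e0.
  have H (j : nat) : exists B, [/\ measurable B, (P B <= (j.+1%:R^-1)%:E)%E &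
      [set w | forall m, exists n, e <= `|\sum_(0 <= k < n) u (m + k)%N w|] `<=` B].
    have [] := tail (e ^+ 2 / j.+1%:R); first by rewrite divr_gt0// exprn_gt0.
    move=> m hm.
    have filF' : is_filtration (fun k => F (m + k)%N).
      by case: filF => h1 h2 h3; split => // t t' tt'; apply: h3; rewrite leq_add2l.
    have mu' : martingale_difference P (fun k => F (m + k)%N) (fun k => u (m + k)%N).
      by move=> k; rewrite addnS; exact: mu.
    have [B [mB PB] hB] := maximal_inequality filF' mu' (fun k w => uc (m + k)%N w) e0 hm.
    exists B; split => //.
      by move: PB; rewrite mulrAC divff ?mul1r// gt_eqF// exprn_gt0.
    by move=> w /= /(_ m)[n]; exact: hB.
  have [B hB] := choice H.
  exists (\bigcap_j B j); split.
  - by apply: bigcapT_measurable => j; case: (hB j).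
  - apply/eqP; rewrite eq_le measure_ge0 andbT.
    have mb : measurable (\bigcap_j B j).
      by apply: bigcapT_measurable => j; case: (hB j).
    apply/lee_addgt0Pr => r r0; rewrite add0e.
    have [j jr] : exists j : nat, j.+1%:R^-1 <= r.
      have := near_infty_natSinv_lt (PosNum r0).
      by move=> -[N _ /(_ N (leqnn _))/= /ltW ?]; exists N.
    have [mBj PBj _] := hB j.
    apply: le_trans (le_trans PBj _); last by rewrite lee_fin.
    apply: le_measure; rewrite ?inE//; exact: bigcap_inf.
  - by move=> w hw j _; case: (hB j) => _ _; apply.
have aex : {ae P, forall w, forall j : nat, exists m, forall n,
    `|\sum_(0 <= k < n) u (m + k)%N w| < j.+1%:R^-1}.
  apply/ae_foralln => j; have j0 : 0 < j.+1%:R^-1 :> R by [].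
  apply: negligibleS (ex _ j0) => w /=.
  move=> /forallNP h m; have /existsNP[n /negP] := h m.
  by rewrite -leNgt => ?; exists n.
apply: filterS aex => w hw.
apply/cauchy_cvgP/cauchy_seriesP => e e0.
have [j jr] : exists j : nat, j.+1%:R^-1 <= e / 2.
  have e20 : 0 < e / 2 by rewrite divr_gt0.
  have := near_infty_natSinv_lt (PosNum e20).
  by move=> -[N _ /(_ N (leqnn _))/= /ltW ?]; exists N.
have [m hm] := hw j.
have S0 n : (m <= n)%N -> `|\sum_(m <= k < n) u k w| < e / 2.
  move=> mn; apply: lt_le_trans jr.
  rewrite -{1}[m]add0n big_addn.
  by under eq_bigr do rewrite addnC.
exists ([set n | (m <= n)%N], [set n | (m <= n)%N]).
  by split; exists m.
move=> [n1 n2] /= [mn1 mn2].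
have [n12|/ltnW n21] := leqP n1 n2; last by rewrite big_geq ?normr0.
have -> : \sum_(n1 <= k < n2) u k w = \sum_(m <= k < n2) u k w - \sum_(m <= k < n1) u k w.
  by rewrite [X in _ = X - _](@big_cat_nat _ _ _ n1)//= addrAC subrr add0r.
apply: le_lt_trans (ler_normB _ _) _.
by rewrite [e]splitr ltrD// S0.
Qed.

End martingale_convergence.

(** * Noise generated by the observations *)

Section sampling_noise.
Context {d} {T : measurableType d} {R : realType} (P : probability T R).
Context {s m : nat} (Pbar : 'I_m -> 'I_s -> R) (F : nat -> set_system T).
Context (X : nat -> T -> 'I_m) (Y : nat -> T -> 'I_s).
Hypotheses (Pbar0 : forall x y, 0 <= Pbar x y) (filF : is_filtration F)
  (smp : is_sampling P F Pbar X Y).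

Local Notation obs t x y := [set w | X t w = x /\ Y t w = y].

Lemma sum_obs (c : 'I_m -> 'I_s -> T -> R) t w :
  c (X t w) (Y t w) w = \sum_(p : 'I_m * 'I_s) c p.1 p.2 w * \1_(obs t p.1 p.2) w.
Proof.
rewrite (bigD1 (X t w, Y t w))//= indicE mem_set// mulr1 big1 ?addr0//.
move=> [x y] /= /eqP xy; rewrite indicE memNset ?mulr0// => -[] XE YE.
by apply: xy; rewrite XE YE.
Qed.

(** The observation takes finitely many values, so a variable that depends on it
    and on the past is a finite sum of past variables times indicators, each
    independent of the past; conditioning on the past replaces the indicators by
    the masses Pbar. *)
Lemma sampling_martingale_difference (c : nat -> 'I_m -> 'I_s -> T -> R) :
  (forall t x y, measurable_for (F t) (c t x y)) ->
  (forall t x y, bounded_rv (c t x y)) ->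
  (forall t w, \sum_(p : 'I_m * 'I_s) Pbar p.1 p.2 * c t p.1 p.2 w = 0) ->
  martingale_difference P F (fun t w => c t (X t w) (Y t w) w).
Proof.
move=> mc bc c0 t; case: (filF) => sF Fm Fnd.
have mE x y : F t.+1 (obs t x y) := (smp t x y).1.
have mE' x y : measurable (obs t x y) by exact: Fm (mE x y).
split.
  rewrite (_ : (fun w => _) = (fun w =>
    \sum_(p : 'I_m * 'I_s) c t p.1 p.2 w * \1_(obs t p.1 p.2) w)); last first.
    by apply/funext => w; exact: (sum_obs (c t)).
  apply: measurable_sum => p; apply: measurable_funM.
    by apply: measurable_forS (mc t p.1 p.2) => //; exact: Fnd.
  apply: measurable_indic; exact: sub_sigma_algebra.
move=> f mf [C fC].
have mfc p : measurable_for (F t) (fun w => f w * c t p.1 p.2 w).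
  by apply: measurable_funM; [exact: mf|exact: mc].
have bfc p : bounded_rv (fun w => f w * c t p.1 p.2 w).
  have [K cK] := bc t p.1 p.2; exists (C * K) => w.
  by rewrite normrM ler_pM.
have mfc' p := measurable_for_measurable (sF t) (Fm t) (mfc p).
under eq_Rintegral.
  move=> w _; rewrite (sum_obs (c t)) mulr_sumr.
  under eq_bigr do rewrite mulrA.
  over.
have RE (r : seq ('I_m * 'I_s)) :
    P.-integrable [set: T] (EFin \o (fun w =>
      \sum_(p <- r) (f w * c t p.1 p.2 w * \1_(obs t p.1 p.2) w))) /\
    \int[P]_w (\sum_(p <- r) (f w * c t p.1 p.2 w * \1_(obs t p.1 p.2) w)) =
    \int[P]_w (f w * \sum_(p <- r) (Pbar p.1 p.2 * c t p.1 p.2 w)) /\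
    P.-integrable [set: T] (EFin \o (fun w =>
      (f w * \sum_(p <- r) (Pbar p.1 p.2 * c t p.1 p.2 w)))).
  have zint : P.-integrable [set: T] (EFin \o (fun w : T => 0 : R)).
    apply: bounded_rv_integrable; first exact: measurable_cst.
    by exists 0 => w; rewrite normr0.
  elim: r => [|p r [IH1 [IH2 IH3]]].
    split; first by under [X in _ \o X]eq_fun do rewrite big_nil.
    split; last by under [X in _ \o X]eq_fun do rewrite big_nil mulr0.
    by apply: eq_Rintegral => w _; rewrite !big_nil mulr0.
  have i1 : P.-integrable [set: T] (EFin \o (fun w =>
      f w * c t p.1 p.2 w * \1_(obs t p.1 p.2) w)).
    apply: bounded_rv_integrable.
      by apply: measurable_funM => //; exact: measurable_indic.
    have [K hK] := bfc p; exists K => w; rewrite normrM indicE.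
    case: (w \in _); rewrite (normr1, normr0) ?mulr1 ?mulr0//.
    exact: le_trans (hK w).
  have i2 : P.-integrable [set: T] (EFin \o (fun w =>
      Pbar p.1 p.2 * (f w * c t p.1 p.2 w))).
    apply: bounded_rv_integrable; first by apply: measurable_funM.
    have [K hK] := bfc p; exists (Pbar p.1 p.2 * K) => w.
    by rewrite normrM ler_pM// ger0_norm.
  split.
    under [X in _ \o X]eq_fun do rewrite big_cons.
    exact: (integrableD measurableT i1 IH1).
  split; last first.
    under [X in _ \o X]eq_fun do rewrite big_cons mulrDr mulrCA.
    exact: (integrableD measurableT i2 IH3).
  under eq_Rintegral do rewrite big_cons.
  under [RHS]eq_Rintegral do rewrite big_cons mulrDr mulrCA.
  rewrite RintegralD// RintegralD// IH2; congr (_ + _).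
  rewrite (@Rintegral_indep _ _ _ _ (F t) _ (Pbar p.1 p.2))//; last first.
    by move=> A /(smp t p.1 p.2).2.
  by rewrite RintegralZl//; exact: bounded_rv_integrable.
have [_ [-> _]] := RE (index_enum _).
under eq_Rintegral do rewrite c0 mulr0.
by rewrite Rintegral_cst// mul0r.
Qed.

End sampling_noise.

(** * Scores and gradients in the expectation parameters *)

Section score_theory.
Context {R : realType} {s m : nat}.
Implicit Types (eta zeta theta v : 'rV[R]_(nparam s m)) (x : 'I_m) (y : 'I_s).

(** The vector that represents the linear form eta |-> score eta x y; its mean
    under the joint model is the vector of expectation parameters. *)
Definition suffstat x y : 'rV[R]_(nparam s m) :=
  row_mx (stat y) (mxvec ((delta_mx 0 y)^T *m (stat x : 'rV[R]_(m.-1)))).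

Lemma scoreE eta x y : score eta x y = (suffstat x y *m eta^T) 0 0.
Proof.
rewrite -[eta in RHS]hsubmxK tr_row_mx mul_row_col mxE /score.
rewrite -[rsubmx eta in RHS]vec_mxK mxvec_dotmul -rowE.
by congr (_ + _); rewrite !mxE; apply: eq_bigr => j _; rewrite !mxE mulrC.
Qed.

Lemma scoreD eta v x y : score (eta + v) x y = score eta x y + score v x y.
Proof. by rewrite !scoreE linearD mulmxDr mxE. Qed.

Lemma scoreZ a v x y : score (a *: v) x y = a * score v x y.
Proof. by rewrite !scoreE linearZ/= -scalemxAr mxE. Qed.

Lemma scoreN v x y : score (- v) x y = - score v x y.
Proof. by rewrite -scaleN1r scoreZ mulN1r. Qed.

Lemma alphaE theta j : alpha theta 0 j = theta 0 (lshift _ j).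
Proof. by rewrite mxE. Qed.

Lemma betaE theta y i : beta theta y i = theta 0 (rshift _ (mxvec_index y i)).
Proof. by rewrite !mxE. Qed.

Lemma stat_nonref n (i : 'I_n) (j : 'I_n.-1) : stat (R:=R) i 0 j = (i == nonref j)%:R.
Proof. by rewrite mxE. Qed.

(** The statistic, completed at the reference class by what is missing from 1, is
    the indicator of the class; this is the completion rule of dual_label and
    dual_joint. *)
Lemma insub_stat n (i k : 'I_n) :
  (if insub (k : nat) is Some j then stat i 0 j
   else 1 - \sum_(j < n.-1) stat i 0 j) = (i == k)%:R :> R.
Proof.
case: insubP => [j _ jk|/negbTE kn].
  by rewrite stat_nonref; congr (_ == _)%:R; apply: val_inj.
under eq_bigr do rewrite stat_nonref.
rewrite (@sum_nonref R n (fun l => (i == l)%:R) k)//.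
rewrite (bigD1 i)//= eqxx big1; first by rewrite addr0 opprB addrC subrK.
by move=> l /negbTE; rewrite eq_sym => ->.
Qed.

(** suffstat x' y' is the vector of expectation parameters of the Dirac mass at
    (x', y'). *)
Lemma dual_joint_suffstat x' y' x y :
  dual_joint (suffstat x' y') x y = ((x' == x) && (y' == y))%:R.
Proof.
have aE : alpha (suffstat x' y') = stat y' by rewrite /alpha row_mxKl.
have bE k i : beta (suffstat x' y') k i = (y' == k)%:R * stat x' 0 i.
  by rewrite /beta /suffstat row_mxKr mxvecK mxE big_ord1 !mxE eqxx eq_sym.
have lE : dual_label (suffstat x' y') y = (y' == y)%:R.
  by rewrite /dual_label aE insub_stat.
rewrite /dual_joint lE -mulnb natrM -(insub_stat x' x).
case: insubP => [i _ _|_]; first by rewrite bE mulrC.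
under eq_bigr do rewrite bE.
by rewrite -mulr_sumr mulrBl mul1r mulrC.
Qed.

(** dual_joint is affine in its parameters; this is its linear part. *)
Definition mass_differential v x y := dual_joint v x y - dual_joint 0 x y.

Lemma dual_joint_affine theta v (t : R) x y :
  dual_joint (theta + t *: v) x y = dual_joint theta x y + t * mass_differential v x y.
Proof.
have aE j : alpha (theta + t *: v) 0 j = alpha theta 0 j + t * alpha v 0 j.
  by rewrite !mxE.
have bE i : beta (theta + t *: v) y i = beta theta y i + t * beta v y i.
  by rewrite !mxE.
have a0 j : alpha (0 : 'rV[R]_(nparam s m)) 0 j = 0 by rewrite !mxE.
have b0 i : beta (0 : 'rV[R]_(nparam s m)) y i = 0 by rewrite !mxE.
have lE : dual_label (theta + t *: v) y =
    dual_label theta y + t * (dual_label v y - dual_label (0 : 'rV[R]_(nparam s m)) y).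
  rewrite /dual_label; case: insubP => [j _ _|_]; first by rewrite aE a0 subr0.
  under eq_bigr do rewrite aE.
  under [X in _ - (1 - X)]eq_bigr do rewrite a0.
  by rewrite big_split/= -mulr_sumr big1_eq; ring.
rewrite /mass_differential /dual_joint; case: insubP => [i _ _|_].
  by rewrite bE b0 subr0.
under eq_bigr do rewrite bE.
under [X in _ - (_ - X)]eq_bigr do rewrite b0.
by rewrite lE big_split/= -mulr_sumr big1_eq; ring.
Qed.

Lemma differentiable_dual_joint theta x y :
  differentiable (fun theta => dual_joint theta x y) theta.
Proof.
have da j : differentiable (fun theta => alpha theta 0 j) theta.
  under eq_fun do rewrite alphaE; exact: differentiable_coord.
have db i : differentiable (fun theta => beta theta y i) theta.
  under eq_fun do rewrite betaE; exact: differentiable_coord.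
have dl : differentiable (fun theta => dual_label theta y) theta.
  rewrite /dual_label; case: insubP => [j _ _|_]; first exact: da.
  apply: differentiableB => //.
  rewrite (_ : (fun _ => _) = \sum_(j < s.-1) (fun theta => alpha theta 0 j)).
    exact: differentiable_sum.
  by apply/funext => z; rewrite fct_sumE.
rewrite /dual_joint; case: insubP => [i _ _|_]; first exact: db.
apply: differentiableB => //.
rewrite (_ : (fun _ => _) = \sum_(i < m.-1) (fun theta => beta theta y i)).
  exact: differentiable_sum.
by apply/funext => z; rewrite fct_sumE.
Qed.

Lemma diff_dual_joint theta v x y :
  'd (fun theta => dual_joint theta x y) theta v = mass_differential v x y.
Proof.
rewrite -deriveE; last exact: differentiable_dual_joint.
apply/cvg_lim => //; apply: cvg_near_cst; near=> t.
rewrite /= [t *: v + _]addrC dual_joint_affine addrAC subrr add0r.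
rewrite [_ *: _]mulrA mulVf ?mul1r//; near: t; exact: nbhs_dnbhs_neq.
Unshelve. all: by end_near. Qed.

Lemma differentiable_ln_dual_joint theta x y : 0 < dual_joint theta x y ->
  differentiable (fun theta => ln (dual_joint theta x y)) theta.
Proof.
move=> p0; rewrite -[fun _ => _]/(@ln R \o (fun theta => dual_joint theta x y)).
apply: differentiable_comp; first exact: differentiable_dual_joint.
by apply/derivable1_diffP; apply: ex_derive; exact: is_derive1_ln.
Qed.

Lemma diff_ln_dual_joint theta v x y : 0 < dual_joint theta x y ->
  'd (fun theta => ln (dual_joint theta x y)) theta v =
  mass_differential v x y / dual_joint theta x y.
Proof.
move=> p0.
have dln : differentiable (@ln R) (dual_joint theta x y).
  by apply/derivable1_diffP; apply: ex_derive; exact: is_derive1_ln.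
rewrite -[fun _ => _]/(@ln R \o (fun theta => dual_joint theta x y)).
rewrite diff_comp//; last exact: differentiable_dual_joint.
rewrite /= diff_dual_joint diff1E// derive1E.
by rewrite (@derive_val _ _ _ _ _ _ _ (is_derive1_ln p0)).
Qed.

Lemma differentiable_h x theta : (forall y, 0 < dual_joint theta x y) ->
  differentiable (h x) theta.
Proof.
move=> p0.
rewrite (_ : h x = \sum_(y < s)
   (fun theta => ln (dual_joint theta x y) *: (delta_mx 0 y : 'rV[R]_s))); last first.
  apply/funext => z; rewrite fct_sumE; apply/rowP => j.
  rewrite mxE summxE (bigD1 j)//= !mxE !eqxx mulr1 big1 ?addr0// => i ij.
  by rewrite !mxE eq_sym (negbTE ij) andbF mulr0.
apply: differentiable_sum => y; apply: differentiableZl.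
exact: differentiable_ln_dual_joint.
Qed.

Lemma mul_grad_h x theta v y : (forall y, 0 < dual_joint theta x y) ->
  (v *m grad_h x theta) 0 y = mass_differential v x y / dual_joint theta x y.
Proof.
move=> p0; have dh := differentiable_h p0.
rewrite -deriveEjacobian// derive_mx; last exact: diff_derivable.
rewrite mxE -diff_ln_dual_joint// -deriveE; last exact: differentiable_ln_dual_joint.
by congr ('D_v _ theta); apply/funext => z; rewrite mxE.
Qed.

End score_theory.

(** * Effect of a step on the scores *)

Section softmax.
Context {R : realType} {s m : nat}.
Implicit Types (eta zeta theta v : 'rV[R]_(nparam s m)) (x : 'I_m) (y : 'I_s).

Lemma sum_expR_score_gt0 eta x y : 0 < \sum_y' expR (score eta x y').
Proof.
rewrite (bigD1 y)//= ltr_pwDl ?expR_gt0//.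
by apply: sumr_ge0 => i _; exact: expR_ge0.
Qed.

Lemma conditional_gt0 eta x y : 0 < conditional eta x y.
Proof. by rewrite divr_gt0 ?expR_gt0// (sum_expR_score_gt0 _ _ y). Qed.

Lemma sum_conditional eta x y : \sum_y' conditional eta x y' = 1.
Proof.
by rewrite -mulr_suml divff// gt_eqF// (sum_expR_score_gt0 _ _ y).
Qed.

Lemma conditional_le1 eta x y : conditional eta x y <= 1.
Proof.
rewrite -(sum_conditional eta x y) (bigD1 y)//= lerDl.
by apply: sumr_ge0 => i _; exact: ltW (conditional_gt0 _ _ _).
Qed.

(** A constant k added to all scores of an input cancels in the conditional
    probabilities; the scores then act by exponential reweighting. *)
Lemma conditional_shift eta eta' x (D : 'I_s -> R) (k : R) y :
  (forall y, score eta' x y = score eta x y + D y + k) ->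
  conditional eta' x y =
  conditional eta x y * expR (D y) / \sum_y' conditional eta x y' * expR (D y').
Proof.
move=> sE; have Z0 := sum_expR_score_gt0 eta x y.
have W0 : 0 < \sum_y' expR (score eta x y') * expR (D y').
  rewrite (bigD1 y)//= ltr_pwDl ?mulr_gt0 ?expR_gt0//.
  by apply: sumr_ge0 => i _; rewrite mulr_ge0 ?expR_ge0.
have -> : \sum_y' conditional eta x y' * expR (D y') =
    (\sum_y' expR (score eta x y') * expR (D y')) / \sum_y' expR (score eta x y').
  by rewrite mulr_suml; apply: eq_bigr => i _; rewrite /conditional mulrAC.
have eE i : expR (score eta' x i) = expR (score eta x i) * expR (D i) * expR k.
  by rewrite sE expRD (expRD _ (D i)).
rewrite /conditional eE.
under [X in _ / X = _]eq_bigr do rewrite eE.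
rewrite -mulr_suml.
move: (\sum_i _) (\sum_i _) Z0 W0 => A B A0 B0.
by field; rewrite !gt_eqF ?expR_gt0.
Qed.

Lemma joint_gt0 zeta x y : 0 < joint zeta x y.
Proof.
rewrite divr_gt0 ?expR_gt0// (bigD1 x)//= ltr_pwDl ?(sum_expR_score_gt0 _ _ y)//.
by apply: sumr_ge0 => i _; exact: ltW (sum_expR_score_gt0 _ _ y).
Qed.

(** The constant k collects the contribution of the reference classes, i.e. of
    the value of the affine map dual_joint at the origin. *)
Lemma score_DSNGD_step (gam : R) zeta eta x y : exists k, forall x' y',
  score (DSNGD_step gam (dual zeta) x y eta) x' y' = score eta x' y' +
    - (gam * (x == x')%:R * (conditional eta x' y' - (y == y')%:R) /
       joint zeta x' y') + k.
Proof.
have p0 y' : 0 < dual_joint (dual zeta) x y' by rewrite dual_joint_dual joint_gt0.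
exists (gam * \sum_y'' dual_joint 0 x y'' / joint zeta x y'' *
  (conditional eta x y'' - (y == y'')%:R)) => x' y'.
rewrite /DSNGD_step scoreD scoreN scoreZ -[RHS]addrA; congr (_ + _).
rewrite [score _^T _ _]scoreE trmxK mulmxA mxE.
transitivity (- (gam * \sum_y'' (((x' == x) && (y' == y''))%:R - dual_joint 0 x y'')
    / joint zeta x y'' * (conditional eta x y'' - (y == y'')%:R))).
  congr (- (_ * _)); apply: eq_bigr => y'' _.
  rewrite mul_grad_h// /mass_differential dual_joint_suffstat dual_joint_dual.
  by rewrite !mxE eqxx andbT (eq_sym y'').
under eq_bigr do rewrite !mulrBl.
rewrite sumrB mulrBr opprD opprK; congr (- _ + _).
rewrite -!mulrA; congr (_ * _).
rewrite (bigD1 y')//= eqxx andbT big1 ?addr0; last first.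
  by move=> i /negbTE; rewrite eq_sym => ->; rewrite andbF !mul0r.
rewrite eq_sym; have [->|] := eqVneq x x'; last by rewrite !mul0r.
by rewrite !mul1r mulrC.
Qed.

Lemma sum_stat n (i k : 'I_n) (f : 'I_n -> R) : (k < n.-1)%N = false -> f k = 0 ->
  \sum_(j < n.-1) stat i 0 j * f (nonref j) = f i.
Proof.
move=> kn fk; under eq_bigr do rewrite stat_nonref.
rewrite (@sum_nonref R n (fun l => (i == l)%:R * f l) k)//= fk mulr0 subr0.
rewrite (bigD1 i)//= eqxx mul1r big1 ?addr0// => l /negbTE.
by rewrite eq_sym => ->; rewrite mul0r.
Qed.

(** The model is saturated.  With ys and xm the reference classes, take
    alpha_y = D xm y - D xm ys and beta_(y, x) = D x y - D xm y; the constant is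
    then - D xm ys. *)
Lemma score_surjective (x0 : 'I_m) (y0 : 'I_s) (D : 'I_m -> 'I_s -> R) (M : R) :
  (forall x y, `|D x y| <= M) ->
  exists v : 'rV[R]_(nparam s m), (forall j, `|v 0 j| <= M *+ 2) /\
    exists k, forall x y, score v x y = D x y + k.
Proof.
move=> DM.
have predlt n (i : 'I_n) : (n.-1 < n)%N by case: n i => [[]//|n _]; rewrite ltnS.
pose xm := Ordinal (predlt m x0); pose ys := Ordinal (predlt s y0).
have MM a b c d : `|D a b - D c d| <= M *+ 2.
  by apply: le_trans (ler_normB _ _) _; rewrite mulr2n lerD.
pose v : 'rV[R]_(nparam s m) := row_mx (\row_j (D xm (nonref j) - D xm ys))
  (mxvec (\matrix_(y, i) (D (nonref i) y - D xm y))).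
exists v; split.
  move=> j; rewrite /v; case: (splitP j) => [i ji|i ji].
    by rewrite (_ : j = lshift _ i) ?row_mxEl ?mxE//; apply: val_inj.
  rewrite (_ : j = rshift _ i) ?row_mxEr; last exact: val_inj.
  by case/mxvec_indexP: i {ji} => a b; rewrite mxvecE mxE.
exists (- D xm ys) => x y.
have aE j : alpha v 0 j = D xm (nonref j) - D xm ys by rewrite /alpha row_mxKl mxE.
have bE i : beta v y i = D (nonref i) y - D xm y by rewrite /beta row_mxKr mxvecK mxE.
have -> : score v x y = \sum_j stat y 0 j * (D xm (nonref j) - D xm ys) +
    \sum_i stat x 0 i * (D (nonref i) y - D xm y).
  rewrite /score !mxE; congr (_ + _); apply: eq_bigr => j _.
    by rewrite [_^T _ _]mxE aE.
  by rewrite [_^T _ _]mxE [row _ _ _ _]mxE bE.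
rewrite (@sum_stat s y ys (fun l => D xm l - D xm ys)) ?ltnn ?subrr//.
rewrite (@sum_stat m x xm (fun l => D l y - D xm y)) ?ltnn ?subrr//.
by rewrite addrC addrA subrK.
Qed.

End softmax.

(** * Second order bounds on the loss *)

Section logsumexp.
Context {R : realType}.

Lemma ln_le_sub1 (z : R) : 0 < z -> ln z <= z - 1.
Proof. by move=> z0; rewrite -{1}[z](subrKC 1) le_ln1Dx//; lra. Qed.

(** From 1 - z <= exp (- z), as 1 <= (1 - z) (1 + z + 2 z^2) for z <= 1/2. *)
Lemma expR_le_quadratic (z : R) : z <= 2^-1 -> expR z <= 1 + z + z ^+ 2 *+ 2.
Proof.
move=> z2; have e0 := expR_gt0 z.
have : (1 - z) * expR z <= 1.
  have := expR_ge1Dx (- z); rewrite expRN => h.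
  by rewrite -ler_pdivlMr// mul1r.
have z1 : 0 < 1 - z by lra.
rewrite mulrC -ler_pdivlMr// => /le_trans; apply.
rewrite ler_pdivrMr// mulr2n; nra.
Qed.

(** For M <= 1/2 the quadratic bound on the exponential applies; for larger M the
    trivial bound M is already below - M + 4 M^2. *)
Lemma ln_sum_expR_le (I : finType) (q D : I -> R) (M : R) :
  (forall i, 0 <= q i) -> \sum_i q i = 1 -> (forall i, `|D i| <= M) ->
  ln (\sum_i q i * expR (D i)) <= \sum_i q i * D i + M ^+ 2 *+ 4.
Proof.
move=> q0 q1 DM.
have I0 : exists i : I, True.
  apply: contrapT => nI; move: q1; rewrite big1 => [/eqP|i _].
    by rewrite eq_sym oner_eq0.
  by exfalso; apply: nI; exists i.
have M0 : 0 <= M by case: I0 => i _; exact: le_trans (DM i).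
have Z0 : 0 < \sum_i q i * expR (D i).
  apply: (@lt_le_trans _ _ (\sum_i q i * expR (- M))).
    by rewrite -mulr_suml q1 mul1r expR_gt0.
  apply: ler_sum => i _; rewrite ler_wpM2l// ler_expR.
  by have := DM i; rewrite ler_norml => /andP[].
have [M1|M1] := leP M 2^-1.
  apply: (le_trans (ln_le_sub1 Z0)).
  apply: (@le_trans _ _ (\sum_i q i * (1 + D i + M ^+ 2 *+ 2) - 1)).
    rewrite lerD2r; apply: ler_sum => i _; rewrite ler_wpM2l//.
    have Di := DM i; apply: le_trans (expR_le_quadratic _) _.
      by apply: le_trans (ler_norm _) _; exact: le_trans Di M1.
    by rewrite lerD2l lerMn2r/= -real_normK ?num_real// lerXn2r ?nnegrE.
  have -> K : \sum_i q i * (1 + D i + K) - 1 = \sum_i q i * D i + K.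
    under eq_bigr do rewrite !mulrDr mulr1.
    by rewrite !big_split/= q1 -mulr_suml q1 mul1r; ring.
  by rewrite lerD2l ler_wpMn2l ?sqr_ge0.
have h1 : ln (\sum_i q i * expR (D i)) <= M.
  rewrite -[leRHS]expRK ler_ln ?posrE ?expR_gt0//.
  apply: (@le_trans _ _ (\sum_i q i * expR M)).
    apply: ler_sum => i _; rewrite ler_wpM2l// ler_expR.
    exact: le_trans (ler_norm _) (DM i).
  by rewrite -mulr_suml q1 mul1r.
have h2 : - M <= \sum_i q i * D i.
  rewrite -[leLHS]mul1r -q1 mulr_suml; apply: ler_sum => i _; rewrite ler_wpM2l//.
  by have := DM i; rewrite ler_norml => /andP[].
have h3 : M *+ 2 <= M ^+ 2 *+ 4.
  rewrite !mulrS mulr0n; nra.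
move: h1 h2 h3; rewrite mulr2n; lra.
Qed.

End logsumexp.

Section loss_theory.
Context {R : realType} {s m : nat} (Pbar : 'I_m -> 'I_s -> R).
Hypothesis pmfP : is_pmf Pbar.
Implicit Types (eta : 'rV[R]_(nparam s m)) (x : 'I_m) (y : 'I_s).

Definition input_mass x := \sum_y Pbar x y.

(** The derivative of the loss with respect to the score at (x, y). *)
Definition residual eta x y := input_mass x * conditional eta x y - Pbar x y.

Let Pbar0 x y : 0 <= Pbar x y. Proof. by case: pmfP. Qed.

Lemma input_mass_ge0 x : 0 <= input_mass x.
Proof. exact: sumr_ge0. Qed.

Lemma input_mass_le1 x : input_mass x <= 1.
Proof.
case: pmfP => _ <-; rewrite (bigD1 x)//= lerDl.
by apply: sumr_ge0 => i _; exact: input_mass_ge0.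
Qed.

Lemma Pbar_le_input_mass x y : Pbar x y <= input_mass x.
Proof. by rewrite /input_mass (bigD1 y)//= lerDl sumr_ge0. Qed.

Lemma sum_residual eta x y : \sum_y' residual eta x y' = 0.
Proof. by rewrite sumrB -mulr_sumr (sum_conditional _ _ y) mulr1 subrr. Qed.

Lemma residual_norm_le1 eta x y : `|residual eta x y| <= 1.
Proof.
have q0 := ltW (conditional_gt0 eta x y); have q1 := conditional_le1 eta x y.
have r0 := input_mass_ge0 x; have r1 := input_mass_le1 x.
have p0 := Pbar0 x y; have p1 := Pbar_le_input_mass x y.
have : input_mass x * conditional eta x y <= 1 by rewrite mulr_ile1.
have : 0 <= input_mass x * conditional eta x y by rewrite mulr_ge0.
rewrite /residual ler_norml; lra.
Qed.

Lemma loss_descent eta eta' (D : 'I_m -> 'I_s -> R) (k : 'I_m -> R) (M : R) :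
  (forall x y, score eta' x y = score eta x y + D x y + k x) ->
  (forall x y, `|D x y| <= M) ->
  loss Pbar eta' <= loss Pbar eta + \sum_x \sum_y residual eta x y * D x y + M ^+ 2 *+ 4.
Proof.
move=> sE DM.
have H x : \sum_y Pbar x y * - ln (conditional eta' x y) <=
    \sum_y Pbar x y * - ln (conditional eta x y) + \sum_y residual eta x y * D x y +
    input_mass x * (M ^+ 2 *+ 4).
  have [y0 _|s0] := pickP 'I_s; last first.
    by rewrite /input_mass !big_pred0 ?mul0r ?addr0.
  pose Z := \sum_y conditional eta x y * expR (D x y).
  have q0 y : 0 < conditional eta x y * expR (D x y).
    by rewrite mulr_gt0 ?conditional_gt0 ?expR_gt0.
  have Z0 : 0 < Z.
    rewrite /Z (bigD1 y0)//= ltr_pwDl//.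
    by apply: sumr_ge0 => i _; exact: ltW.
  have lnE y : - ln (conditional eta' x y) = - ln (conditional eta x y) - D x y + ln Z.
    rewrite (conditional_shift y (sE x)) -/Z ln_div ?posrE//.
    by rewrite lnM ?posrE ?expR_gt0 ?conditional_gt0// expRK; ring.
  under eq_bigr do rewrite lnE !mulrDr.
  rewrite !big_split/= -!addrA lerD2l -mulr_suml -/(input_mass x).
  have := @ln_sum_expR_le R _ (conditional eta x) (D x) M
    (fun y => ltW (conditional_gt0 eta x y)) (sum_conditional eta x y0) (DM x).
  rewrite -/Z => /(ler_wpM2l (input_mass_ge0 x)) h.
  apply: (@le_trans _ _ (\sum_y Pbar x y * - D x y +
      input_mass x * (\sum_y conditional eta x y * D x y + M ^+ 2 *+ 4))).
    by rewrite lerD2l.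
  rewrite mulrDr addrA lerD2r mulr_sumr -big_split/=.
  by apply: ler_sum => y _; rewrite le_eqVlt; apply/orP; left; apply/eqP;
    rewrite /residual; ring.
rewrite /loss; apply: (le_trans (ler_sum _ (fun x _ => H x))).
rewrite !big_split/= -mulr_suml lerD2l.
by case: pmfP => _ ->; rewrite mul1r.
Qed.

Lemma sum_residual_sqr eta : 0 <= \sum_x \sum_y residual eta x y ^+ 2.
Proof. by apply: sumr_ge0 => x _; apply: sumr_ge0 => y _; exact: sqr_ge0. Qed.

(** By score_surjective the scores can be moved along - e/4 times the residual,
    and loss_descent then bounds the sum of the squared residuals by e. *)
Lemma solution_residual eta x y : is_solution Pbar eta -> residual eta x y = 0.
Proof.
move=> sol.
set S := \sum_x \sum_y residual eta x y ^+ 2.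
have S0 : S <= 0.
  apply/ler_addgt0Pr => e e0; rewrite add0r.
  have e4 : 0 < e / 4 by rewrite divr_gt0.
  pose D x y := - (e / 4) * residual eta x y.
  have DM x' y' : `|D x' y'| <= e / 4.
    by rewrite normrM normrN (gtr0_norm e4) ler_piMr ?residual_norm_le1// ltW.
  have [v [_ [k vE]]] := score_surjective x y DM.
  have := @loss_descent eta (eta + v) D (fun=> k) (e / 4).
  have sE x' y' : score (eta + v) x' y' = score eta x' y' + D x' y' + k.
    by rewrite scoreD vE addrA.
  move=> /(_ sE DM) /(le_trans (sol (eta + v))).
  have -> : \sum_x \sum_y residual eta x y * D x y = - (e / 4) * S.
    rewrite mulr_sumr; apply: eq_bigr => i _; rewrite mulr_sumr.
    by apply: eq_bigr => j _; rewrite /D; ring.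
  have -> : (e / 4) ^+ 2 *+ 4 = e / 4 * e by field.
  by rewrite -addrA lerDl mulNr addrC subr_ge0 ler_pM2l.
have S_eq0 : S = 0 by apply/eqP; rewrite eq_le S0 sum_residual_sqr.
have row0 x' : true -> 0 <= \sum_y' residual eta x' y' ^+ 2.
  by move=> _; apply: sumr_ge0 => y' _; exact: sqr_ge0.
have hx : \sum_y' residual eta x y' ^+ 2 = 0 := psumr_eq0P row0 S_eq0 isT.
have : residual eta x y ^+ 2 = 0.
  exact: (psumr_eq0P (fun y' _ => sqr_ge0 (residual eta x y')) hx isT).
by move=> /eqP; rewrite sqrf_eq0 => /eqP.
Qed.

Lemma loss_ext eta eta' :
  (forall x y, 0 < Pbar x y -> conditional eta x y = conditional eta' x y) ->
  loss Pbar eta = loss Pbar eta'.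
Proof.
move=> ee; apply: eq_bigr => x _; apply: eq_bigr => y _.
have := Pbar0 x y; rewrite le_eqVlt => /orP[/eqP <-|/ee ->//].
by rewrite !mul0r.
Qed.

End loss_theory.

(** * Relative entropy, Hellinger distance and chi-square divergence *)

Section relative_entropy.
Context {R : realType} {I : finType} (p q : I -> R).
Hypotheses (p0 : forall i, 0 <= p i) (q0 : forall i, 0 < p i -> 0 < q i)
  (q00 : forall i, p i = 0 -> q i = 0) (pq : \sum_i p i = \sum_i q i).

Definition relative_entropy := \sum_i p i * ln (p i / q i).

Let q_ge0 i : 0 <= q i.
Proof.
have := p0 i; rewrite le_eqVlt => /orP[/eqP/esym/q00 ->//|/q0/ltW//].
Qed.

(** Sum over j, with weights 2 p j, the inequality ln z <= z - 1 at
    z = sqrt (q j / p j). *)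
Lemma hellinger_le_relative_entropy i :
  (Num.sqrt (p i) - Num.sqrt (q i)) ^+ 2 <= relative_entropy.
Proof.
apply: (@le_trans _ _ (\sum_j (Num.sqrt (p j) - Num.sqrt (q j)) ^+ 2)).
  by rewrite (bigD1 i)//= lerDl; apply: sumr_ge0 => j _; exact: sqr_ge0.
apply: (@le_trans _ _ (\sum_j ((p j - Num.sqrt (p j) * Num.sqrt (q j)) *+ 2))).
  have qp0 : \sum_j (q j - p j) = 0 by rewrite sumrB pq subrr.
  rewrite -[leRHS]addr0 -[X in _ <= _ + X]qp0 -big_split/=.
  apply: ler_sum => j _; rewrite sqrrB sqr_sqrtr// sqr_sqrtr//.
  by rewrite le_eqVlt; apply/orP; left; apply/eqP; ring.
apply: ler_sum => j _; have := p0 j; rewrite le_eqVlt => /orP[/eqP <-|pj0].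
  by rewrite sqrtr0 !mul0r subrr mul0rn.
have qj0 := q0 pj0; have sp0 : 0 < Num.sqrt (p j) by rewrite sqrtr_gt0.
have sq0 : 0 < Num.sqrt (q j) by rewrite sqrtr_gt0.
have -> : p j / q j = (Num.sqrt (q j) / Num.sqrt (p j)) ^- 2.
  by rewrite expr_div_n !sqr_sqrtr// invf_div.
rewrite -exprVn lnXn ?invr_gt0 ?divr_gt0// lnV ?posrE ?divr_gt0//.
have := ln_le_sub1 (divr_gt0 sq0 sp0).
move=> /(ler_wpM2l (p0 j)) h; rewrite mulrnAr ler_pMn2r// mulrN lerNr opprB.
apply: (le_trans h); have := sqr_sqrtr (p0 j).
move: (Num.sqrt (p j)) (Num.sqrt (q j)) sp0 => u v u0 <-.
by rewrite le_eqVlt; apply/orP; left; apply/eqP; field; rewrite gt_eqF.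
Qed.

(** ln z <= z - 1 at z = p i / q i gives the chi-square divergence with q in the
    denominators, and q >= p / 2 by hypothesis. *)
Lemma relative_entropy_le_chi2 : (forall i, `|q i - p i| <= p i / 2) ->
  relative_entropy <= (\sum_i (q i - p i) ^+ 2 / p i) *+ 2.
Proof.
move=> close.
have -> : (\sum_i (q i - p i) ^+ 2 / p i) *+ 2 =
    \sum_i ((p i - q i) + (q i - p i) ^+ 2 / p i *+ 2).
  by rewrite big_split/= sumrB pq subrr add0r sumrMnl.
apply: ler_sum => i _; have := p0 i; rewrite le_eqVlt => /orP[/eqP/esym pi0|pi0].
  by rewrite pi0 (q00 pi0) !mul0r subrr add0r expr0n/= mul0r mul0rn.
have qi0 := q0 pi0; have := ln_le_sub1 (divr_gt0 pi0 qi0).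
move=> /(ler_wpM2l (p0 i)) /le_trans; apply.
have -> : p i * (p i / q i - 1) = (p i - q i) + (q i - p i) ^+ 2 / q i.
  by field; rewrite gt_eqF.
rewrite lerD2l -mulrnAr ler_wpM2l ?sqr_ge0//.
have -> : (p i)^-1 *+ 2 = (p i / 2)^-1 by field; rewrite gt_eqF.
rewrite lef_pV2 ?posrE ?divr_gt0//.
have := close i; rewrite ler_norml; lra.
Qed.

End relative_entropy.

(** * A descent recursion with a summable perturbation *)

Section perturbed_descent.
Context {R : realType}.

(** Subtracting the partial sums of b makes D nonincreasing, so D has a limit l.
    If l > 0, then S stays above some c > 0 and the total decrease, at least c
    times the divergent sum of gam, exceeds what is available. *)
Lemma perturbed_descent_cvg0 (D S gam b : nat -> R) :
  (forall t, 0 <= D t) -> (forall t, 0 < gam t) -> (forall t, 0 <= S t) ->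
  series gam @ \oo --> +oo -> cvgn (series b) ->
  (forall t, D t.+1 <= D t - gam t * S t + b t) ->
  (forall e, 0 < e -> exists2 c, 0 < c & forall t, S t < c -> D t < e) ->
  D @ \oo --> 0.
Proof.
move=> D0 g0 S0 goo bc rec small.
pose V t := D t - series b t.
have VS t : V t.+1 <= V t - gam t * S t.
  by rewrite /V seriesSr; have := rec t; lra.
have Vni : nonincreasing_seq V.
  apply/nonincreasing_seqP => t; apply: le_trans (VS t) _.
  by rewrite gerBl mulr_ge0// ltW.
have [M [_ Mb]] := cvg_seq_bounded bc.
have bM t : `|series b t| <= M + 1 by apply: (Mb (M + 1)); rewrite // ltrDl.
have Vlb t : - (M + 1) <= V t.
  by have := bM t; have := D0 t; rewrite /V ler_norml; lra.
have Vc : cvgn V.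
  by apply: nonincreasing_is_cvgn => //; exists (- (M + 1)) => _ [t _ <-].
have DE : D = V \+ series b by apply/funext => t; rewrite /V /= subrK.
have Dc : cvgn D by rewrite DE; exact: is_cvgD.
set l := limn D; have Dl : D @ \oo --> l by exact: Dc.
have l0 : 0 <= l by apply: limr_ge => //; exact: nearW.
have [<-//|l_neq0] := eqVneq l 0.
have lgt0 : 0 < l by rewrite lt_neqAle eq_sym l_neq0.
have l20 : 0 < l / 2 by rewrite divr_gt0.
have [c c0 hc] := small _ l20.
have [N _ hN] : \forall t \near \oo, l / 2 <= D t.
  move/cvgrPdist_le : Dl => /(_ _ l20); apply: filterS => t.
  rewrite ler_norml; lra.
have SN t : (N <= t)%N -> c <= S t.
  by move=> /hN /= Dt; rewrite leNgt; apply/negP => /hc; rewrite ltNge Dt.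
have sum k : c * (series gam (N + k)%N - series gam N) <= V N - V (N + k)%N.
  elim: k => [|k IH]; first by rewrite addn0 !subrr mulr0.
  rewrite addnS seriesSr; have := VS (N + k)%N; have := SN (N + k)%N (leq_addr _ _).
  move=> /(ler_wpM2l (ltW (g0 (N + k)%N))); nra.
move/cvgryPgt : goo => /(_ (series gam N + (V N + (M + 1)) / c)) [n _ hn].
have := hn (N + n)%N (leq_addl _ _); rewrite /= -ltrBrDl => h.
have := sum n; rewrite leNgt => /negP; case.
apply: (@le_lt_trans _ _ (V N + (M + 1))); first by have := Vlb (N + n)%N; lra.
by move: h; rewrite ltr_pdivrMr// [_ * c]mulrC.
Qed.

End perturbed_descent.

(** * First order gain of a step *)

Section natural_gain.
Context {R : realType} {s m : nat} (Pbar : 'I_m -> 'I_s -> R).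
Hypothesis pmfP : is_pmf Pbar.
Implicit Types (eta zeta : 'rV[R]_(nparam s m)) (rho : 'I_m -> 'I_s -> R)
  (x : 'I_m) (y : 'I_s).

(** With rho = 1 / P_zeta, - gam * gain is the first order change of the loss in a
    step from eta at the observation (x, y), and mean_gain is the mean of gain
    over (x, y) drawn from Pbar (gain_centered).  A general rho leaves room for
    truncation. *)
Definition gain rho eta x y := \sum_y'
  residual Pbar eta x y' * (conditional eta x y' - (y == y')%:R) * rho x y'.

Definition mean_gain rho eta := \sum_x \sum_y residual Pbar eta x y ^+ 2 * rho x y.

Lemma gain_centered rho eta :
  \sum_(p : 'I_m * 'I_s) Pbar p.1 p.2 * (mean_gain rho eta - gain rho eta p.1 p.2) = 0.
Proof.
under eq_bigr do rewrite mulrBr.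
rewrite sumrB -mulr_suml.
rewrite -(pair_bigA _ (fun x y => Pbar x y)).
rewrite -(pair_bigA _ (fun x y => Pbar x y * gain rho eta x y))/=.
case: (pmfP) => _ ->; rewrite mul1r; apply/eqP; rewrite subr_eq0; apply/eqP.
apply: eq_bigr => x _; rewrite /gain.
under [RHS]eq_bigr do rewrite mulr_sumr.
rewrite exchange_big/=; apply: eq_bigr => y' _.
rewrite (eq_bigr (fun y => residual Pbar eta x y' * rho x y' *
  (Pbar x y * conditional eta x y' - Pbar x y * (y == y')%:R))); last by move=> y _; ring.
rewrite -mulr_sumr sumrB -mulr_suml [X in _ - X](bigD1 y')//= eqxx mulr1
  [X in _ - (_ + X)]big1 ?addr0; last first.
  by move=> y /negbTE ->; rewrite mulr0.
by rewrite -/(input_mass Pbar x) -/(residual Pbar eta x y') expr2; ring.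
Qed.

Lemma conditional_sub_le1 eta x y (b : bool) : `|conditional eta x y - b%:R| <= 1.
Proof.
have := conditional_gt0 eta x y; have := conditional_le1 eta x y.
by rewrite ler_norml; case: b => /= ? ?; lra.
Qed.

Lemma gain_bound rho eta (K : R) x y :
  (forall x y, 0 <= rho x y) -> (forall x y, rho x y <= K) ->
  `|gain rho eta x y| <= s%:R * K.
Proof.
move=> rho0 rhoK; apply: le_trans (ler_norm_sum _ _ _) _.
apply: (@le_trans _ _ (\sum_(y' < s) K)); last first.
  by rewrite sumr_const card_ord [leRHS]mulr_natl.
apply: ler_sum => y' _; rewrite !normrM (ger0_norm (rho0 x y')).
apply: le_trans (rhoK x y'); rewrite ler_piMl//.
by rewrite mulr_ile1// ?residual_norm_le1// conditional_sub_le1.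
Qed.

Lemma mean_gain_bound rho eta (K : R) :
  (forall x y, 0 <= rho x y) -> (forall x y, rho x y <= K) ->
  `|mean_gain rho eta| <= m%:R * (s%:R * K).
Proof.
move=> rho0 rhoK; apply: le_trans (ler_norm_sum _ _ _) _.
apply: (@le_trans _ _ (\sum_(x < m) (s%:R * K))); last first.
  by rewrite sumr_const card_ord [leRHS]mulr_natl.
apply: ler_sum => x _; apply: le_trans (ler_norm_sum _ _ _) _.
apply: (@le_trans _ _ (\sum_(y' < s) K)); last first.
  by rewrite sumr_const card_ord [leRHS]mulr_natl.
apply: ler_sum => y _; rewrite normrM (ger0_norm (rho0 x y)).
apply: le_trans (rhoK x y); rewrite ler_piMl//.
by rewrite normrX exprn_ile1// residual_norm_le1.
Qed.

Lemma loss_DSNGD_step (gam K : R) zeta eta x y : 0 <= gam ->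
  (forall x y, (joint zeta x y)^-1 <= K) ->
  loss Pbar (DSNGD_step gam (dual zeta) x y eta) <= loss Pbar eta
    - gam * gain (fun x y => (joint zeta x y)^-1) eta x y + (gam * K) ^+ 2 *+ 4.
Proof.
move=> gam0 jK; have [k kE] := score_DSNGD_step gam zeta eta x y.
have K0 : 0 <= K by apply: le_trans (jK x y); rewrite invr_ge0 ltW// joint_gt0.
pose Del x' y' := - (gam * (x == x')%:R *
  (conditional eta x' y' - (y == y')%:R) / joint zeta x' y').
have DelK x' y' : `|Del x' y'| <= gam * K.
  have j0 : 0 <= (joint zeta x' y')^-1 by rewrite invr_ge0 ltW// joint_gt0.
  rewrite /Del normrN !normrM (ger0_norm gam0) (ger0_norm j0) -!mulrA.
  apply: ler_wpM2l => //; apply: le_trans (jK x' y'); rewrite mulrA ler_piMl//.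
  rewrite mulr_ile1// ?conditional_sub_le1//.
  by case: (x == x'); rewrite ?normr1 ?normr0.
apply: le_trans (loss_descent pmfP kE DelK) _.
rewrite lerD2r lerD2l le_eqVlt; apply/orP; left; apply/eqP.
rewrite (bigD1 x)//= [X in _ + X]big1 ?addr0; last first.
  move=> x' /negbTE xx'; apply: big1 => y' _.
  by rewrite eq_sym xx' mulr0 !mul0r oppr0 mulr0.
rewrite /gain mulr_sumr -sumrN; apply: eq_bigr => y' _; rewrite eqxx /=.
by ring.
Qed.

Lemma mean_gain_ge0 rho eta : (forall x y, 0 <= rho x y) -> 0 <= mean_gain rho eta.
Proof.
move=> rho0; apply: sumr_ge0 => x _; apply: sumr_ge0 => y _.
by rewrite mulr_ge0 ?sqr_ge0.
Qed.

Lemma sum_residual_le_mean_gain rho eta : (forall x y, 1 <= rho x y) ->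
  \sum_(p : 'I_m * 'I_s) residual Pbar eta p.1 p.2 ^+ 2 <= mean_gain rho eta.
Proof.
move=> rho1; rewrite -(pair_bigA _ (fun x y => residual Pbar eta x y ^+ 2))/=.
apply: ler_sum => x _; apply: ler_sum => y _.
by rewrite ler_peMr ?sqr_ge0.
Qed.

Variable etabar : 'rV[R]_(nparam s m).
Hypothesis sol : is_solution Pbar etabar.

Lemma Pbar_solution x y : Pbar x y = input_mass Pbar x * conditional etabar x y.
Proof.
by have /eqP := solution_residual pmfP x y sol; rewrite subr_eq0 => /eqP.
Qed.

(** The joint mass with the input marginal of Pbar and the conditional
    probabilities of the model, so that residual is its difference with Pbar. *)
Definition fitted_mass eta (p : 'I_m * 'I_s) := input_mass Pbar p.1 * conditional eta p.1 p.2.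

Let q0 eta p : 0 < Pbar p.1 p.2 -> 0 < fitted_mass eta p.
Proof.
rewrite Pbar_solution /fitted_mass pmulr_lgt0 ?conditional_gt0// => r0.
by rewrite mulr_gt0// conditional_gt0.
Qed.

Let q00 eta p : Pbar p.1 p.2 = 0 -> fitted_mass eta p = 0.
Proof.
rewrite Pbar_solution /fitted_mass => /eqP; rewrite mulf_eq0.
by rewrite (gt_eqF (conditional_gt0 _ _ _)) orbF => /eqP ->; rewrite mul0r.
Qed.

Let pq eta : \sum_p Pbar p.1 p.2 = \sum_p fitted_mass eta p.
Proof.
apply/eqP; rewrite eq_sym -subr_eq0 -sumrB.
rewrite -(pair_bigA _ (fun x y => residual Pbar eta x y))/=; apply/eqP.
apply: big1 => x _; have [y0 _|s0] := pickP 'I_s; last by rewrite big_pred0.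
exact: sum_residual.
Qed.

Lemma loss_gapE eta : loss Pbar eta - loss Pbar etabar =
  relative_entropy (fun p => Pbar p.1 p.2) (fitted_mass eta).
Proof.
rewrite /loss -sumrB /relative_entropy.
rewrite -(pair_bigA _ (fun x y => Pbar x y * ln (Pbar x y / fitted_mass eta (x, y))))/=.
apply: eq_bigr => x _; rewrite -sumrB; apply: eq_bigr => y _.
rewrite -mulrBr; have := pmfP.1 x y; rewrite le_eqVlt => /orP[/eqP <-|p0].
  by rewrite !mul0r.
have r0 : 0 < input_mass Pbar x by exact: lt_le_trans (Pbar_le_input_mass pmfP x y).
congr (_ * _); rewrite Pbar_solution /fitted_mass /=.
rewrite -mulf_div divff ?gt_eqF// mul1r
  [ln (conditional etabar x y / _)]ln_div ?posrE ?conditional_gt0//.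
by rewrite opprK addrC.
Qed.

(** K bounds the inverses of the nonzero masses of Pbar.  The first bound in c
    makes every residual at most half of the corresponding mass, so that the
    relative entropy is at most 2 K times the sum of the squared residuals; the
    second bound makes this less than e. *)
Lemma loss_gap_small (e : R) : 0 < e -> exists2 c, 0 < c &
  forall eta, \sum_(p : 'I_m * 'I_s) residual Pbar eta p.1 p.2 ^+ 2 < c ->
    loss Pbar eta - loss Pbar etabar < e.
Proof.
move=> e0.
pose K := 1 + \sum_(p : 'I_m * 'I_s) (Pbar p.1 p.2)^-1.
have pV p : 0 <= (Pbar p.1 p.2)^-1 by rewrite invr_ge0; exact: pmfP.1.
have K0 : 0 < K by rewrite ltr_pwDl// sumr_ge0.
have pK p : (Pbar p.1 p.2)^-1 <= K.
  rewrite /K (bigD1 p)//= addrCA lerDl addr_ge0// sumr_ge0//.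
pose c := Num.min ((K * 2) ^- 2) (e / (K * 2)).
exists c; first by rewrite lt_min !divr_gt0 ?invr_gt0 ?exprn_gt0 ?mulr_gt0.
move=> eta; set S := \sum_p _ => Sc.
have rS p : residual Pbar eta p.1 p.2 ^+ 2 <= S.
  by rewrite /S (bigD1 p)//= lerDl sumr_ge0// => i _; exact: sqr_ge0.
rewrite loss_gapE.
have close p : `|fitted_mass eta p - Pbar p.1 p.2| <= Pbar p.1 p.2 / 2.
  have := pmfP.1 p.1 p.2; rewrite le_eqVlt => /orP[/eqP/esym p0|p0].
    by rewrite p0 (q00 _ p0) subrr normr0 mul0r.
  apply: (@le_trans _ _ (K * 2)^-1); last first.
    by rewrite invfM ler_pM2r// -[leRHS]invrK lef_pV2 ?posrE ?invr_gt0// pK.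
  have K20 : 0 <= (K * 2)^-1 by rewrite invr_ge0 mulr_ge0// ltW.
  rewrite -(@ler_pXn2r _ 2)// ?nnegrE//.
  rewrite real_normK ?num_real// exprVn; apply: ltW; apply: le_lt_trans (rS p) _.
  by apply: lt_le_trans Sc _; rewrite ge_min lexx.
have := relative_entropy_le_chi2 (fun p => pmfP.1 p.1 p.2)
  (q0 eta) (q00 eta) (pq eta) close.
move=> /le_lt_trans; apply.
apply: (@le_lt_trans _ _ ((S * K) *+ 2)).
  rewrite lerMn2r/= /S mulr_suml; apply: ler_sum => p _.
  by rewrite ler_wpM2l ?sqr_ge0.
rewrite -mulr_natr -mulrA -ltr_pdivlMr ?mulr_gt0//.
by apply: lt_le_trans Sc _; rewrite ge_min lexx orbT.
Qed.

Lemma loss_gap_ge0 eta : 0 <= loss Pbar eta - loss Pbar etabar.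
Proof. by rewrite subr_ge0. Qed.

(** The Hellinger bound gives the convergence of the square roots of the fitted
    masses, hence of their logarithms, as the limit is positive. *)
Lemma ln_conditional_cvg (eta : nat -> 'rV[R]_(nparam s m)) x y :
  (fun t => loss Pbar (eta t) - loss Pbar etabar) @ \oo --> 0 ->
  0 < input_mass Pbar x ->
  (fun t => ln (conditional etabar x y) - ln (conditional (eta t) x y)) @ \oo --> 0.
Proof.
move=> L0 r0.
have p0 : 0 < Pbar x y by rewrite Pbar_solution mulr_gt0 ?conditional_gt0.
pose Q t := fitted_mass (eta t) (x, y).
have sq : (fun t => Num.sqrt (Q t)) @ \oo --> Num.sqrt (Pbar x y).
  apply/cvgrPdist_lt => e e0.
  have e20 : 0 < e ^+ 2 by rewrite exprn_gt0.
  move/cvgrPdist_lt : L0 => /(_ _ e20); apply: filterS => t.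
  rewrite sub0r normrN ger0_norm ?loss_gap_ge0// loss_gapE => h.
  rewrite -(@ltr_pXn2r _ 2)// ?nnegrE ?ltW// real_normK ?num_real//.
  apply: le_lt_trans h.
  exact: (hellinger_le_relative_entropy (fun p => pmfP.1 p.1 p.2)
    (q0 (eta t)) (q00 (eta t)) (pq (eta t)) (x, y)).
have Qp : Q @ \oo --> Pbar x y.
  rewrite -[Pbar x y]sqr_sqrtr ?ltW//.
  rewrite (_ : Q = (fun t => Num.sqrt (Q t) ^+ 2)).
    by rewrite expr2; exact: (cvgM sq sq).
  by apply/funext => t; rewrite sqr_sqrtr// ltW// q0.
have lnQ : (fun t => ln (Pbar x y) - ln (Q t)) @ \oo --> 0.
  rewrite -(subrr (ln (Pbar x y))); apply: cvgB; first exact: cvg_cst.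
  by apply: continuous_cvg => //; exact: continuous_ln.
apply: cvg_trans lnQ; apply: near_eq_cvg; apply: nearW => t.
have lnE eta' : ln (input_mass Pbar x * conditional eta' x y) =
    ln (input_mass Pbar x) + ln (conditional eta' x y).
  by rewrite [LHS]lnM ?posrE ?conditional_gt0.
by rewrite /Q /fitted_mass /= Pbar_solution !lnE opprD addrACA subrr add0r.
Qed.

End natural_gain.

(** * Measurability and boundedness along the iteration *)

Section measurability.
Context {d} {T : measurableType d} {R : realType} {s m : nat}.
Implicit Types (G : set_system T) (f : T -> R).

Lemma measurable_wrt_coord G n (u : T -> 'rV[R]_n) i :
  measurable_wrt G u -> measurable_for G (fun w => u w 0 i).
Proof. by move=> uG _ B mB; apply: sub_sigma_algebra; apply: uG; exists B. Qed.

Lemma measurable_for_inv G f : (forall w, 0 < f w) ->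
  measurable_for G f -> measurable_for G (fun w => (f w)^-1).
Proof.
move=> f0 mf; rewrite (_ : (fun w => _) = (fun w => expR (- ln (f w)))).
  apply: (measurableT_comp (@measurable_expR R)).
  apply: measurable_funN; exact: (measurableT_comp (@measurable_ln R)).
by apply/funext => w; rewrite expRN lnK ?posrE.
Qed.

Lemma measurable_for_score G (u : T -> 'rV[R]_(nparam s m)) x y :
  measurable_wrt G u -> measurable_for G (fun w => score (u w) x y).
Proof.
move=> mu.
rewrite (_ : (fun w => _) =
    (fun w => \sum_j suffstat x y 0 j * u w 0 j)); last first.
  by apply/funext => w; rewrite scoreE mxE; apply: eq_bigr => j _; rewrite [_^T _ _]mxE.
apply: measurable_sum => j; apply: measurable_funM; first exact: measurable_cst.
exact: measurable_wrt_coord.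
Qed.

Lemma measurable_for_conditional G (u : T -> 'rV[R]_(nparam s m)) x y :
  measurable_wrt G u -> measurable_for G (fun w => conditional (u w) x y).
Proof.
move=> mu; have me y' : measurable_for G (fun w => expR (score (u w) x y')).
  apply: (measurableT_comp (@measurable_expR R)); exact: measurable_for_score.
have mZ : measurable_for G (fun w => (\sum_y' expR (score (u w) x y'))^-1).
  apply: measurable_for_inv; last exact: measurable_sum.
  by move=> w; exact: (sum_expR_score_gt0 _ _ y).
exact: (measurable_funM (me y) mZ).
Qed.

Lemma measurable_for_dual_joint G (u : T -> 'rV[R]_(nparam s m)) x y :
  measurable_wrt G u -> measurable_for G (fun w => dual_joint (u w) x y).
Proof.
move=> mu.
have ma j : measurable_for G (fun w => alpha (u w) 0 j).
  by under eq_fun do rewrite alphaE; exact: measurable_wrt_coord.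
have mb i : measurable_for G (fun w => beta (u w) y i).
  by under eq_fun do rewrite betaE; exact: measurable_wrt_coord.
have ml : measurable_for G (fun w => dual_label (u w) y).
  rewrite /dual_label; case: insubP => [j _ _|_]; first exact: ma.
  apply: measurable_funB; [exact: measurable_cst|exact: measurable_sum].
rewrite /dual_joint; case: insubP => [i _ _|_]; first exact: mb.
by apply: measurable_funB => //; exact: measurable_sum.
Qed.

End measurability.

Section joint_theory.
Context {R : realType} {s m : nat}.
Implicit Types (zeta : 'rV[R]_(nparam s m)) (x : 'I_m) (y : 'I_s).

Lemma joint_le1 zeta x y : joint zeta x y <= 1.
Proof.
have s0 : (0 < s)%N by exact: leq_ltn_trans (ltn_ord y).
have m0 : (0 < m)%N by exact: leq_ltn_trans (ltn_ord x).
rewrite -(sum_joint zeta s0 m0) (bigD1 y)//= (bigD1 x)//= -addrA lerDl addr_ge0//.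
  by apply: sumr_ge0 => *; exact: ltW (joint_gt0 _ _ _).
by apply: sumr_ge0 => *; apply: sumr_ge0 => *; exact: ltW (joint_gt0 _ _ _).
Qed.

Lemma cvg_sumr I (r : seq I) (f : I -> nat -> R) (l : I -> R) :
  (forall i, f i @ \oo --> l i) ->
  (fun t => \sum_(i <- r) f i t) @ \oo --> \sum_(i <- r) l i.
Proof.
move=> fl; elim: r => [|i r IH].
  by under eq_fun do rewrite big_nil; rewrite big_nil; exact: cvg_cst.
by under eq_fun do rewrite big_cons; rewrite big_cons; exact: cvgD.
Qed.

Lemma score_cvg (zeta : nat -> 'rV[R]_(nparam s m)) l x y :
  zeta @ \oo --> l -> (fun t => score (zeta t) x y) @ \oo --> score l x y.
Proof.
move=> zl; have sE z : score z x y = \sum_j suffstat x y 0 j * z 0 j.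
  by rewrite scoreE mxE; apply: eq_bigr => j _; rewrite [_^T _ _]mxE.
rewrite sE; under eq_fun do rewrite sE.
apply: cvg_sumr => j; apply: cvgM; first exact: cvg_cst.
exact: (continuous_cvg _ (@coord_continuous _ _ _ 0 j l) zl).
Qed.

Lemma joint_cvg (zeta : nat -> 'rV[R]_(nparam s m)) l x y :
  zeta @ \oo --> l -> (fun t => joint (zeta t) x y) @ \oo --> joint l x y.
Proof.
move=> zl.
have e x' y' : (fun t => expR (score (zeta t) x' y')) @ \oo --> expR (score l x' y').
  by apply: continuous_cvg; [exact: continuous_expR|exact: score_cvg].
apply: cvgM => //; apply: cvgV.
  rewrite gt_eqF// (bigD1 x)//= ltr_pwDl ?(sum_expR_score_gt0 _ _ y)//.
  by apply: sumr_ge0 => i _; exact: ltW (sum_expR_score_gt0 _ _ y).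
by apply: cvg_sumr => x'; apply: cvg_sumr => y'; exact: e.
Qed.

Lemma joint_inv_bounded (zeta : nat -> 'rV[R]_(nparam s m)) : cvgn zeta ->
  exists K : nat, forall t x y, (joint (zeta t) x y)^-1 <= K.+1%:R.
Proof.
move=> zc.
have H (p : 'I_m * 'I_s) : exists M : R, forall t, (joint (zeta t) p.1 p.2)^-1 <= M.
  have : cvgn (fun t => (joint (zeta t) p.1 p.2)^-1).
    apply/cvg_ex; exists (joint (limn zeta) p.1 p.2)^-1.
    by apply: cvgV; [rewrite gt_eqF// joint_gt0|exact: joint_cvg].
  move=> /cvg_seq_bounded[M [_ Mb]]; exists (M + 1) => t.
  by apply: le_trans (ler_norm _) _; apply: (Mb (M + 1)); rewrite // ltrDl.
have [M hM] := choice H.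
exists (Num.trunc (\sum_p `|M p|)) => t x y.
apply: le_trans (hM (x, y) t) _; apply: le_trans (ler_norm _) _.
apply: (@le_trans _ _ (\sum_p `|M p|)); last by apply: ltW; exact: truncnS_gt.
by rewrite (bigD1 (x, y))//= lerDl sumr_ge0.
Qed.

End joint_theory.

(** * Convergence of the iteration *)

Section DSNGD.
Context {R : realType} {s m : nat}
  {d : measure_display} {T : measurableType d} (P : probability T R)
  (Pbar : 'I_m -> 'I_s -> R) (F : nat -> set_system T)
  (X : nat -> T -> 'I_m) (Y : nat -> T -> 'I_s) (gamma : nat -> R)
  (zetas zeta eta : nat -> T -> 'rV[R]_(nparam s m)).
Hypotheses (pmfP : is_pmf Pbar) (filF : is_filtration F)
  (smp : is_sampling P F Pbar X Y) (gamma0 : forall t, 0 < gamma t)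
  (mzetas : forall t, measurable_wrt (F t) (zetas t))
  (zetasE : forall t w, zetas t w = dual (zeta t w))
  (meta0 : measurable_wrt (F 0%N) (eta 0%N))
  (etaE : forall t w,
     eta t.+1 w = DSNGD_step (gamma t) (zetas t w) (X t w) (Y t w) (eta t w)).

Let sF t : sigma_algebra [set: T] (F t). Proof. by case: filF. Qed.

Let jointE t w x y : joint (zeta t w) x y = dual_joint (zetas t w) x y.
Proof. by rewrite zetasE dual_joint_dual. Qed.

Lemma measurable_joint_inv t x y :
  measurable_for (F t) (fun w => (joint (zeta t w) x y)^-1).
Proof.
apply: measurable_for_inv => [w|]; first exact: joint_gt0.
by under eq_fun do rewrite jointE; exact: measurable_for_dual_joint.
Qed.

Lemma measurable_observation t (c : 'I_m -> 'I_s -> R) :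
  measurable_for (F t.+1) (fun w => c (X t w) (Y t w)).
Proof.
rewrite (_ : (fun w => _) = (fun w =>
  \sum_(p : 'I_m * 'I_s) c p.1 p.2 * \1_([set w | X t w = p.1 /\ Y t w = p.2]) w)).
  apply: measurable_sum => p; apply: measurable_funM; first exact: measurable_cst.
  by apply: measurable_indic; apply: sub_sigma_algebra; exact: (smp t p.1 p.2).1.
by apply/funext => w; exact: (sum_obs X Y (fun x y _ => c x y)).
Qed.

(** By score_DSNGD_step and conditional_shift the conditional probabilities obey a
    recursion of their own, driven by the masses of the dual parameters and the
    observation. *)
Lemma measurable_conditional t x y :
  measurable_for (F t) (fun w => conditional (eta t w) x y).
Proof.
elim: t x y => [|t IH] x y; first exact: measurable_for_conditional.
have FS : F t `<=` F t.+1 by case: filF => _ _; apply.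
have mq x' y' := measurable_forS (sF t) FS (IH x' y').
have mj x' y' := measurable_forS (sF t) FS (@measurable_joint_inv t x' y').
pose Del w y' := - (gamma t * (X t w == x)%:R *
  (conditional (eta t w) x y' - (Y t w == y')%:R) / joint (zeta t w) x y').
have mDel y' : measurable_for (F t.+1) (fun w => expR (Del w y')).
  have mX : measurable_for (F t.+1) (fun w => gamma t * (X t w == x)%:R).
    have mo := @measurable_observation t (fun x0 _ => (x0 == x)%:R).
    exact: (measurable_funM (measurable_cst (gamma t)) mo).
  have mY : measurable_for (F t.+1)
      (fun w => conditional (eta t w) x y' - (Y t w == y')%:R).
    have mo := @measurable_observation t (fun _ y0 => (y0 == y')%:R).
    exact: (measurable_funB (mq x y') mo).
  apply: (measurableT_comp (@measurable_expR R)).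
  exact: (measurable_funN (measurable_funM (measurable_funM mX mY) (mj x y'))).
rewrite (_ : (fun w => _) = (fun w => conditional (eta t w) x y * expR (Del w y) /
    \sum_y' conditional (eta t w) x y' * expR (Del w y'))).
  have mqD y' : measurable_for (F t.+1)
      (fun w => conditional (eta t w) x y' * expR (Del w y')).
    exact: (measurable_funM (mq x y') (mDel y')).
  have mZ : measurable_for (F t.+1)
      (fun w => (\sum_y' conditional (eta t w) x y' * expR (Del w y'))^-1).
    apply: measurable_for_inv; last exact: measurable_sum.
    move=> w; have q0 y' : 0 < conditional (eta t w) x y' * expR (Del w y').
      by rewrite mulr_gt0 ?conditional_gt0 ?expR_gt0.
    by rewrite (bigD1 y)//= ltr_pwDl// sumr_ge0// => i _; exact: ltW.
  exact: (measurable_funM (mqD y) mZ).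
apply/funext => w; rewrite etaE zetasE.
have [k kE] := score_DSNGD_step (gamma t) (zeta t w) (eta t w) (X t w) (Y t w).
exact: conditional_shift (kE x).
Qed.

(** Truncation makes the noise bounded.  The truncated inverse masses remain at
    least 1, which keeps the mean gain above the sum of the squared residuals. *)
Let rho (K t : nat) w x y := Num.min (joint (zeta t w) x y)^-1 K.+1%:R.

Let rho_ge1 K t w x y : 1 <= rho K t w x y.
Proof.
rewrite le_min ler1n andbT -invr1 lef_pV2 ?posrE ?joint_gt0//.
exact: joint_le1.
Qed.

Let rho_ge0 K t w x y : 0 <= rho K t w x y.
Proof. exact: le_trans (rho_ge1 _ _ _ _ _). Qed.

Let rho_leK K t w x y : rho K t w x y <= K.+1%:R.
Proof. by rewrite ge_min lexx orbT. Qed.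

Definition gain_noise (K t : nat) x y w := gamma t *
  (mean_gain Pbar (rho K t w) (eta t w) - gain Pbar (rho K t w) (eta t w) x y).

Lemma measurable_gain_noise K t x y : measurable_for (F t) (gain_noise K t x y).
Proof.
have mrho x' y' : measurable_for (F t) (fun w => rho K t w x' y').
  by apply: measurable_minr; [exact: measurable_joint_inv|exact: measurable_cst].
have mres x' y' : measurable_for (F t) (fun w => residual Pbar (eta t w) x' y').
  apply: measurable_funB; last exact: measurable_cst.
  by apply: measurable_funM; [exact: measurable_cst|exact: measurable_conditional].
have mq y' : measurable_for (F t) (fun w => conditional (eta t w) x y' - (y == y')%:R).
  exact: (measurable_funB (@measurable_conditional t x y') (measurable_cst _)).
have mM : measurable_for (F t) (fun w => mean_gain Pbar (rho K t w) (eta t w)).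
  apply: measurable_sum => x'; apply: measurable_sum => y'.
  exact: (measurable_funM (measurable_funX 2 (mres x' y')) (mrho x' y')).
have mG : measurable_for (F t) (fun w => gain Pbar (rho K t w) (eta t w) x y).
  apply: measurable_sum => y'.
  exact: (measurable_funM (measurable_funM (mres x y') (mq y')) (mrho x y')).
exact: (measurable_funM (measurable_cst (gamma t)) (measurable_funB mM mG)).
Qed.

Let noise_bound (K : nat) : R := m%:R * (s%:R * K.+1%:R) + s%:R * K.+1%:R.

Lemma gain_noise_bound K t x y w :
  `|gain_noise K t x y w| <= gamma t * noise_bound K.
Proof.
rewrite /gain_noise normrM (gtr0_norm (gamma0 t)).
apply: ler_wpM2l; first exact: ltW.
apply: le_trans (ler_normB _ _) _; apply: lerD.
  by apply: mean_gain_bound.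
by apply: gain_bound.
Qed.

(** The truncation levels range over the integers, so that one null set serves
    them all. *)
Lemma gain_noise_series_cvg : cvgn (series (fun t => gamma t ^+ 2)) ->
  {ae P, forall w K, cvgn (series (fun t => gain_noise K t (X t w) (Y t w) w))}.
Proof.
move=> g2; apply/ae_foralln => K.
apply: (@martingale_difference_series_cvg _ _ _ P F filF
  (fun t w => gain_noise K t (X t w) (Y t w) w) (fun t => gamma t * noise_bound K)).
- apply: (sampling_martingale_difference pmfP.1 filF smp).
  + by move=> t x y; exact: measurable_gain_noise.
  + by move=> t x y; exists (gamma t * noise_bound K) => w; exact: gain_noise_bound.
  + move=> t w; have := gain_centered pmfP (rho K t w) (eta t w).
    move=> /(congr1 ( *%R (gamma t))); rewrite mulr0 mulr_sumr; apply: etrans.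
    by apply: eq_bigr => p _; rewrite mulrCA.
- by move=> t w; exact: gain_noise_bound.
- rewrite (_ : (fun k => _) = noise_bound K ^+ 2 *: (fun k => gamma k ^+ 2)).
    exact: is_cvg_seriesZ.
  by apply/funext => t; rewrite exprMn mulrC.
Qed.

Variable etabar : 'rV[R]_(nparam s m).
Hypothesis sol : is_solution Pbar etabar.

(** K is chosen on the given path, above the inverse masses at all times. *)
Lemma loss_cvg w : series gamma @ \oo --> +oo ->
  cvgn (series (fun t => gamma t ^+ 2)) -> cvgn (zeta ^~ w) ->
  (forall K, cvgn (series (fun t => gain_noise K t (X t w) (Y t w) w))) ->
  (fun t => loss Pbar (eta t w) - loss Pbar etabar) @ \oo --> 0.
Proof.
move=> goo g2 /joint_inv_bounded[K jK] nc.
have rhoE t : rho K t w = (fun x y => (joint (zeta t w) x y)^-1).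
  by apply/funext => x; apply/funext => y; apply/min_idPl; exact: jK.
pose b t := gain_noise K t (X t w) (Y t w) w + (gamma t * K.+1%:R) ^+ 2 *+ 4.
apply: (@perturbed_descent_cvg0 R _
  (fun t => mean_gain Pbar (rho K t w) (eta t w)) gamma b).
- by move=> t; exact: loss_gap_ge0.
- by [].
- by move=> t; exact: mean_gain_ge0.
- by [].
- rewrite (_ : b = (fun t => gain_noise K t (X t w) (Y t w) w) +
      (K.+1%:R ^+ 2 *+ 4) *: (fun t => gamma t ^+ 2)).
    by apply: is_cvg_seriesD => //; exact: is_cvg_seriesZ.
  apply/funext => t; rewrite /b fctE /=; congr (_ + _).
  by rewrite [RHS]mulrnAl exprMn mulrC.
- move=> t; rewrite etaE zetasE /b /gain_noise rhoE.
  have := loss_DSNGD_step pmfP (eta t w) (X t w) (Y t w) (ltW (gamma0 t)) (jK t).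
  move: (loss _ (DSNGD_step _ _ _ _ _)) (gain _ _ _ _ _) (mean_gain _ _ _) => A g mg.
  move: (loss _ _) (loss _ _) (_ *+ 4) => B C Q; lra.
- move=> e /(loss_gap_small pmfP sol)[c c0 hc]; exists c => // t Sc; apply: hc.
  by apply: le_lt_trans Sc; exact: sum_residual_le_mean_gain.
Qed.

(** The loss only sees the inputs charged by Pbar.  There, adding to the scores
    of eta_t the differences of log-probabilities gives the conditional
    probabilities of etabar; elsewhere the scores are left alone.  The parameter
    vector that realises this correction has norm at most twice its size. *)
Lemma converges_to_solutions w :
  (fun t => loss Pbar (eta t w) - loss Pbar etabar) @ \oo --> 0 ->
  converges_to_set (eta ^~ w) (is_solution Pbar).
Proof.
move=> L0 e e0; have e4 : 0 < e / 4 by rewrite divr_gt0.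
pose gap t x y : R := if 0 < input_mass Pbar x then
  ln (conditional etabar x y) - ln (conditional (eta t w) x y) else 0.
have near_gap (p : 'I_m * 'I_s) : \forall t \near \oo, `|gap t p.1 p.2| <= e / 4.
  move: p => [x y] /=; rewrite /gap.
  have [r0|r0] := ltP 0 (input_mass Pbar x); last first.
    by apply: nearW => t; rewrite normr0 ltW.
  have := @ln_conditional_cvg _ _ _ _ pmfP _ sol (eta ^~ w) x y L0 r0.
  move/cvgrPdist_le => /(_ _ e4); apply: filterS => t.
  by rewrite sub0r normrN.
apply: filterS (filter_forall _ near_gap) => t small.
have x0 := X t w; have y0 := Y t w.
have [v [vs [k vE]]] := score_surjective x0 y0 (fun x y => small (x, y)).
exists (eta t w + v); last first.
  rewrite opprD addrA subrr add0r normrN -[`|v|]/(mx_norm v).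
  have [->//|/mx_norm_neq0[[i j] /= ->]] := eqVneq (mx_norm v) 0.
  rewrite ord1; apply: le_lt_trans (vs j) _; rewrite mulr2n; lra.
move=> eta'; apply: le_trans (sol eta'); rewrite le_eqVlt; apply/orP; left; apply/eqP.
apply: loss_ext => // x y p0.
have r0 : 0 < input_mass Pbar x by exact: lt_le_trans (Pbar_le_input_mass pmfP x y).
have sE y' : score (eta t w + v) x y' = score (eta t w) x y' + gap t x y' + k.
  by rewrite scoreD vE addrA.
have gE y' : conditional (eta t w) x y' * expR (gap t x y') = conditional etabar x y'.
  rewrite /gap r0 expRB !lnK ?posrE ?conditional_gt0//.
  by rewrite mulrC divfK// gt_eqF// conditional_gt0.
rewrite (conditional_shift y sE) gE.
under eq_bigr do rewrite gE.
by rewrite (sum_conditional _ _ y) divr1.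
Qed.

End DSNGD.

Theorem theorem5 (R : realType) (s m : nat)
    (d : measure_display) (T : measurableType d) (P : probability T R)
    (Pbar : 'I_m -> 'I_s -> R)
    (F : nat -> set_system T)
    (X : nat -> T -> 'I_m) (Y : nat -> T -> 'I_s)
    (gamma : nat -> R)
    (zetas zeta eta : nat -> T -> 'rV[R]_(nparam s m))
    (etabar : 'rV[R]_(nparam s m)) :
  is_pmf Pbar ->
  is_solution Pbar etabar ->
  is_filtration F ->
  is_sampling P F Pbar X Y ->
  (forall t, 0 < gamma t) ->
  series gamma @ \oo --> +oo ->
  cvgn (series (fun t => gamma t ^+ 2)) ->
  (forall t, measurable_wrt (F t) (zetas t)) ->
  (forall t w, zetas t w = dual (zeta t w)) ->
  {ae P, forall w, cvgn (fun t => zeta t w)} ->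
  measurable_wrt (F 0%N) (eta 0%N) ->
  (forall t w,
     eta t.+1 w = DSNGD_step (gamma t) (zetas t w) (X t w) (Y t w) (eta t w)) ->
  {ae P, forall w, converges_to_set (fun t => eta t w) (is_solution Pbar)} /\
  ((forall theta, is_solution Pbar theta -> theta = etabar) ->
   {ae P, forall w, (fun t => eta t w) @ \oo --> etabar}).
Proof.
move=> pmfP sol filF smp gamma0 goo g2 mzetas zetasE zc meta0 etaE.
have conv : {ae P, forall w, converges_to_set (fun t => eta t w) (is_solution Pbar)}.
  have := gain_noise_series_cvg pmfP filF smp gamma0 mzetas zetasE meta0 etaE g2.
  apply: filterS2 zc => w zw nw.
  apply: (converges_to_solutions X Y pmfP sol).
  exact: (loss_cvg pmfP gamma0 zetasE etaE sol goo g2 zw nw).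
split=> // uniq; apply: filterS conv => w cw.
apply/cvgrPdist_lt => e e0; apply: filterS (cw e e0) => t [a /uniq ->].
by rewrite distrC.
Qed.
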